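(* Let $Y$ be a quasi-projective algebraic manifold. Suppose that each point $y\in Y$ has a Zariski open neighborhood $U\subset Y$ and finitely many algebraic sprays $s_j\colon E_j\to Y$ ($j=1,2,\dots,k$), defined on algebraic vector bundles $p_j\colon E_j\to U$, satisfying $$(ds_1)_{0_y}(E_{1,y})+(ds_2)_{0_y}(E_{2,y})+\cdots+(ds_k)_{0_y}(E_{k,y})=T_yY.$$ (The ranges of the sprays $s_j$ need not be contained in $U$.) Then $Y$ is subelliptic.
   Context: A projective algebraic manifold is a closed complex submanifold of a complex projective space; a quasi-projective algebraic manifold is a Zariski open set in a projective algebraic manifold. For a vector bundle $p\colon E\to U$ let $E_z=p^{-1}(z)$ and let $0_z\in E_z$ be the zero element; $T_{0_z}E=T_zU\oplus E_z$. If $U\subset Y$ is Zariski open and $p\colon E\to U$ is an algebraic vector bundle, an algebraic spray $s\colon E\to Y$ defined on $E$ is an algebraic map $s\colon E\to Y$ such that $s(0_z)=z$ for all $z\in U$. A spray on a complex manifold $Y$ is a holomorphic map $s\colon E\to Y$ from the total space of a holomorphic vector bundle $p\colon E\to Y$ such that $s(0_y)=y$ for all $y\in Y$. The complex manifold $Y$ is subelliptic if it admits finitely many (holomorphic) sprays $s_j\colon E_j\to Y$, $j=1,\dots,k$, such that $\sum_{j=1}^k(ds_j)_{0_y}(E_{j,y})=T_yY$ for every $y\in Y$. *)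

(* Defs.v *)
From HB Require Import structures.
From mathcomp Require Import all_boot all_order all_algebra.
From mathcomp Require Import all_classical all_reals all_analysis.
From mathcomp Require Import complex.
From mathcomp.multinomials Require mpoly.

Set Implicit Arguments.
Unset Strict Implicit.
Unset Printing Implicit Defensive.

Import Order.TTheory GRing.Theory Num.Theory.
Import numFieldNormedType.Exports.

Local Open Scope classical_set_scope.
Local Open Scope ring_scope.

(* Everything is defined over an arbitrary C : numClosedFieldType, but is meant
   to be used with C = R[i], R : realType.  [differentiable] is Frechet
   differentiability over the scalar field C, so a function that is
   differentiable on an open set is holomorphic there. *)

Section ProjectiveSpace.
Variables (C : numClosedFieldType) (n : nat).

(* Points of P^n are the lines through 0 in C^(n+1). *)
Definition CP := {L : {vspace 'rV[C]_n.+1} | \dim L == 1%N}.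

(* A choice of homogeneous coordinates of a point. *)
Definition hcoord (p : CP) : 'rV[C]_n.+1 := vpick (val p).

Lemma hcoord_neq0 p : hcoord p != 0.
Proof. by rewrite vpick0 -dimv_eq0 (eqP (valP p)). Qed.

Lemma hcoord_line p : <[hcoord p]>%VS = val p.
Proof.
apply/eqP; rewrite eqEdim -memvE memv_pick /=.
by rewrite (eqP (valP p)) dim_vline hcoord_neq0.
Qed.

Definition aff_dom (k : 'I_n.+1) : set CP := [set p | hcoord p 0 k != 0].

Definition aff_coord (k : 'I_n.+1) (p : CP) : 'rV[C]_n :=
  \row_j (hcoord p 0 (lift k j) / hcoord p 0 k).

Definition aff_vect (k : 'I_n.+1) (u : 'rV[C]_n) : 'rV[C]_n.+1 :=
  \row_i (if unlift k i is Some j then u 0 j else 1).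

Lemma aff_vect_neq0 k u : aff_vect k u != 0.
Proof.
by apply/eqP => /rowP/(_ k); rewrite !mxE unlift_none; apply/eqP/oner_neq0.
Qed.

Fact aff_point_subproof k u : \dim <[aff_vect k u]> == 1%N.
Proof. by rewrite dim_vline aff_vect_neq0. Qed.

Definition aff_point (k : 'I_n.+1) (u : 'rV[C]_n) : CP :=
  Sub <[aff_vect k u]>%VS (aff_point_subproof k u).

Lemma aff_coordK k p : aff_dom k p -> aff_point k (aff_coord k p) = p.
Proof.
move=> pk; apply/val_inj/eqP; rewrite /= -hcoord_line eqEdim -memvE.
rewrite !dim_vline aff_vect_neq0 hcoord_neq0 andbT.
apply/vlineP; exists (hcoord p 0 k)^-1; apply/rowP => i; rewrite !mxE.
case: unliftP => [j ->|->]; first by rewrite mxE mulrC.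
by rewrite mulVf.
Qed.

Lemma aff_pointP k u :
  exists2 a, a != 0 & hcoord (aff_point k u) = a *: aff_vect k u.
Proof.
have /vlineP[a ea] : hcoord (aff_point k u) \in <[aff_vect k u]>%VS.
  exact: memv_pick.
exists a => //; apply/eqP => a0; have := hcoord_neq0 (aff_point k u).
by rewrite ea a0 scale0r eqxx.
Qed.

Lemma aff_point_dom k u : aff_dom k (aff_point k u).
Proof.
have [a a0 ea] := aff_pointP k u.
by rewrite /aff_dom /= ea !mxE unlift_none mulr1.
Qed.

Lemma aff_pointK k u : aff_coord k (aff_point k u) = u.
Proof.
have [a a0 ea] := aff_pointP k u.
apply/rowP => j; rewrite mxE ea !mxE unlift_none liftK mulr1 mulrC mulKf //.
Qed.

Definition proj_open (O : set CP) : Prop :=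
  forall k, open [set u | O (aff_point k u)].

(* A point of X has an affine chart and biholomorphic coordinates near it in
   which X is a linear coordinate subspace of dimension d; d is allowed to
   differ from one connected component of X to another. *)
Definition complex_submanifold (X : set CP) : Prop :=
  forall p, X p -> exists (k : 'I_n.+1) (d : nat) (W W' : set 'rV[C]_n)
    (h h' : 'rV[C]_n -> 'rV[C]_n),
    [/\ aff_dom k p, open W, open W' & W (aff_coord k p)] /\
    [/\ (forall u, W u -> [/\ W' (h u), h' (h u) = u & differentiable h u]),
        (forall u, W' u -> [/\ W (h' u), h (h' u) = u & differentiable h' u]) &
        forall u, W u ->
          (X (aff_point k u) <-> forall j : 'I_n, (d <= j)%N -> h u 0 j = 0)].

Definition projective_manifold (X : set CP) : Prop :=
  proj_open (~` X) /\ complex_submanifold X.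

(* T_yY, read in the k-th affine chart, as the set of velocities at y of
   holomorphic curves in Y. *)
Definition tangent (Y : set CP) (y : CP) (k : 'I_n.+1) : set 'rV[C]_n :=
  [set w | exists c : C^o -> 'rV[C]_n,
    [/\ c 0 = aff_coord k y,
        (\forall t \near (0 : C^o),
           differentiable c t /\ Y (aff_point k (c t))) &
        'D_1 c 0 = w]].

End ProjectiveSpace.

Section Maps.
Variables (C : numClosedFieldType) (n r : nat).
Implicit Type D : set (CP C n * 'rV[C]_r).

(* The map f = dec \o (local coordinates of f), defined on D, is near q the
   restriction of a holomorphic map defined on an open set of P^n x C^r.
   For functions, dec is the identity; for maps into P^m, dec is the inverse of
   an affine chart. *)
Definition holo_at (V : normedModType C) (T : Type) (dec : V -> T) D
    (f : CP C n * 'rV[C]_r -> T) (q : CP C n * 'rV[C]_r) : Prop :=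
  exists (k : 'I_n.+1) (g : 'rV[C]_n * 'rV[C]_r -> V), aff_dom k q.1 /\
    \forall z \near (aff_coord k q.1, q.2),
      differentiable g z /\
      (D (aff_point k z.1, z.2) -> f (aff_point k z.1, z.2) = dec (g z)).

Definition holo_fun D (f : CP C n * 'rV[C]_r -> C) : Prop :=
  forall q, D q -> holo_at (id : C^o -> C) D f q.

Definition holo_map m D (f : CP C n * 'rV[C]_r -> CP C m) : Prop :=
  forall q, D q -> exists l : 'I_m.+1, holo_at (@aff_point C m l) D f q.

(* Polynomials in x_0, ..., x_n, v_1, ..., v_r. *)
Definition pol := mpoly.mpoly (n.+1 + r) C.

Definition ev (F : pol) (q : CP C n * 'rV[C]_r) : C :=
  mpoly.meval (row_mx (hcoord q.1) q.2 0) F.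

(* F is homogeneous of degree d in x_0, ..., x_n. *)
Definition xhomog (d : nat) (F : pol) : Prop :=
  forall m : mpoly.multinom (n.+1 + r), mpoly.mcoeff m F != 0 ->
    (\sum_(i < n.+1) mpoly.fun_of_multinom m (lshift r i) = d)%N.

Definition zariski_closed (Z : set (CP C n * 'rV[C]_r)) : Prop :=
  exists S : set pol, (forall F, S F -> exists d, xhomog d F) /\
    Z = [set q | forall F, S F -> ev F q = 0].

Definition zariski_open (O : set (CP C n * 'rV[C]_r)) : Prop :=
  zariski_closed (~` O).

Definition regular_fun D (f : CP C n * 'rV[C]_r -> C) : Prop :=
  forall q, D q -> exists (d : nat) (P Q : pol) (O : set (CP C n * 'rV[C]_r)),
    [/\ xhomog d P, xhomog d Q, zariski_open O, O q &
        forall q', D q' -> O q' -> ev Q q' != 0 /\ f q' = ev P q' / ev Q q'].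

Definition regular_map m D (f : CP C n * 'rV[C]_r -> CP C m) : Prop :=
  forall q, D q -> exists (d : nat) (F : 'I_m.+1 -> pol)
    (O : set (CP C n * 'rV[C]_r)),
    [/\ forall i, xhomog d (F i), zariski_open O, O q &
        forall q', D q' -> O q' ->
          \row_i ev (F i) q' != 0 /\ val (f q') = <[\row_i ev (F i) q']>%VS].

End Maps.

Section Bundles.
Variables (C : numClosedFieldType) (n : nat).
Implicit Types (B U Y : set (CP C n)).

(* P^n is identified with P^n x C^0. *)
Definition proj_zariski_open (O : set (CP C n)) : Prop :=
  @zariski_open C n 0 (fst @^-1` O).

Definition proj_regular_fun B (f : CP C n -> C) : Prop :=
  @regular_fun C n 0 (fst @^-1` B) (f \o fst).

Definition proj_holo_fun B (f : CP C n -> C) : Prop :=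
  @holo_fun C n 0 (fst @^-1` B) (f \o fst).

Definition quasi_projective_manifold Y : Prop :=
  exists X O : set (CP C n),
    [/\ projective_manifold X, proj_zariski_open O & Y = X `&` O].

(* Data of a vector bundle over a subset of P^n: the fibres E_z, and local
   trivializations.  Only the fibres over the base B of [is_bundle] matter, and
   the i-th trivialization lives over B `&` triv_dom E i. *)
Record vbundle := VBundle {
  rank : nat;
  fiber : CP C n -> lmodType C;
  idx : Type;
  triv_dom : idx -> set (CP C n);
  triv : idx -> forall z, {linear 'rV[C]_rank -> fiber z} }.

(* opn: the open sets over which trivializations are given; reg: the functions
   allowed as entries of the transition matrices. *)
Definition is_bundle (opn : set (CP C n) -> Prop)
    (reg : set (CP C n) -> (CP C n -> C) -> Prop) B (E : vbundle) : Prop :=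
  [/\ forall z, B z -> exists i, triv_dom (v:=E) i z,
      forall i, opn (triv_dom (v:=E) i),
      forall i z, B z -> triv_dom i z -> bijective (triv (v:=E) i z) &
      forall i j, exists g : CP C n -> 'M[C]_(rank E),
        (forall z v, B z -> triv_dom i z -> triv_dom j z ->
           triv (v:=E) i z v = triv j z (v *m g z)) /\
        (forall a b,
           reg (B `&` triv_dom i `&` triv_dom j) (fun z => g z a b))].

Definition holomorphic_bundle := is_bundle (@proj_open C n) proj_holo_fun.
Definition algebraic_bundle := is_bundle proj_zariski_open proj_regular_fun.

(* s z e is the value at e of a map from the total space to Y. *)
Definition is_spray
    (mor : forall r, set (CP C n * 'rV[C]_r) ->
       (CP C n * 'rV[C]_r -> CP C n) -> Prop)
    B Y (E : vbundle) (s : forall z, fiber E z -> CP C n) : Prop :=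
  [/\ forall z e, B z -> Y (s z e),
      forall z, B z -> s z 0 = z &
      forall i, mor (rank E) [set q | B q.1 /\ triv_dom i q.1]
        (fun q => s q.1 (triv i q.1 q.2))].

Definition holomorphic_spray := is_spray (fun r => @holo_map C n r n).
Definition algebraic_spray := is_spray (fun r => @regular_map C n r n).

(* (ds)_{0_y}(e) for e in E_y, read in the k-th affine chart of P^n: e is the
   velocity at 0_y of the curve t |-> t e in E_y. *)
Definition vert_diff (k : 'I_n.+1) (F : lmodType C) (sy : F -> CP C n) (e : F)
    : 'rV[C]_n :=
  'D_1 (fun t : C^o => aff_coord k (sy ((t : C) *: e))) 0.

Definition sprays_span Y m (E : 'I_m -> vbundle)
    (s : forall j z, fiber (E j) z -> CP C n) (y : CP C n) : Prop :=
  forall k, aff_dom k y ->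
    [set w | exists e : forall j, fiber (E j) y,
       w = \sum_j vert_diff k (s j y) (e j)] = tangent Y y k.

Definition subelliptic Y : Prop :=
  exists (m : nat) (E : 'I_m -> vbundle)
    (s : forall j z, fiber (E j) z -> CP C n),
    [/\ forall j, holomorphic_bundle Y (E j),
        forall j, holomorphic_spray Y Y (s j) &
        forall y, Y y -> sprays_span Y s y].

End Bundles.

(* Main.v *)
Require Import Defs.
From mathcomp Require Import all_boot all_order all_algebra.
From mathcomp Require Import all_classical all_reals all_analysis.
From mathcomp Require Import complex ring.
From mathcomp.multinomials Require mpoly.

(* Trivialize a given bundle near y, so that the spray becomes a map f (z, v) with
   f (z, 0) = z, given near the zero section by homogeneous polynomials:
   f (z, v) = [F_0 : ... : F_n] (z, v) where H (z, v) <> 0.  Let G (z) be the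
   product of F_k (z, 0), H (z, 0) and equations of the complement of the base.
   Since F (z, t v) = F (z, 0) + t Q (z, t, v) with Q polynomial and F (z, 0)
   proportional to z, the map f (z, G (z)^2 v) extends holomorphically by z to
   {G = 0}.  As G is homogeneous, this is a spray over all of Y, defined on a sum
   of copies of the line bundle O (-2 deg G), with the same vertical directions as
   f wherever G is nonzero.  These directions are the row space of a polynomial
   matrix, and they are always tangent to Y; so they span the tangent space at
   every z with the same tangent rank as y at which G and a suitable minor do not
   vanish.  By Hilbert's basis theorem finitely many such sets cover Y. *)

Set Implicit Arguments.
Unset Strict Implicit.
Unset Printing Implicit Defensive.

Import Order.TTheory GRing.Theory Num.Theory.
Import numFieldNormedType.Exports.

Local Open Scope classical_set_scope.
Local Open Scope ring_scope.

(** * Hilbert's basis theorem and polynomial functions *)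

Section Noetherian.

Definition is_ideal (A : comNzRingType) (J : set A) : Prop :=
  [/\ J 0, forall a b, J a -> J b -> J (a + b) & forall c a, J a -> J (c * a)].

(** The intersection of all ideals containing S: membership is exploited by exhibiting one suitable
    ideal, without handling linear combinations. *)
Definition ideal_span (A : comNzRingType) (S : set A) : set A :=
  [set a | forall J, is_ideal J -> S `<=` J -> J a].

Lemma ideal_span_ideal (A : comNzRingType) (S : set A) : is_ideal (ideal_span S).
Proof.
split=> [J [] // | a b ha hb J hJ SJ | c a ha J hJ SJ].
- by have [_ hD _] := hJ; apply: hD; [apply: ha | apply: hb].
- by have [_ _ hM] := hJ; apply: hM; apply: ha.
Qed.

Lemma sub_ideal_span (A : comNzRingType) (S : set A) : S `<=` ideal_span S.
Proof. by move=> a Sa J _; apply. Qed.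

Lemma ideal_span_sub (A : comNzRingType) (S J : set A) :
  is_ideal J -> S `<=` J -> ideal_span S `<=` J.
Proof. by move=> hJ SJ a; apply. Qed.

(** The generators are required to come from S itself, as is needed to extract a finite subcover
    from a given family. *)
Definition noetherian (A : comNzRingType) : Prop :=
  forall S : set A, exists l : seq A,
    (forall a, a \in l -> S a) /\ S `<=` ideal_span [set` l].

Lemma noetherian_field (F : fieldType) : noetherian F.
Proof.
move=> S; have [[a [Sa a0]] | h] := pselect (exists a, S a /\ a != 0).
  exists [:: a]; split=> [b /[!inE]/eqP -> // | b _ J [_ _ hM] lJ].
  by rewrite -(divfK a0 b); apply/hM/lJ; rewrite /= inE.
exists [::]; split=> // a Sa J [J0 _ _] _.
have [-> //|a0] := eqVneq a 0; by case: h; exists a.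
Qed.

(** A form of the ascending chain condition: finitely many terms span the range, and n is taken
    beyond all their indices. *)
Lemma noetherian_sequence (A : comNzRingType) (a : nat -> A) :
  noetherian A -> exists n, ideal_span [set a i | i in `I_n] (a n).
Proof.
move=> hA; have [l [la hl]] := hA (range a).
have [n hn] : exists n, forall b, b \in l -> [set a i | i in `I_n] b.
  elim: l la {hl} => [|b l IHl] la; first by exists 0%N.
  have [n hn] := IHl (fun c cl => la c (@mem_behead _ (b :: l) c cl)).
  have [i _ ab] := la b (mem_head _ _).
  exists (maxn i.+1 n) => c; rewrite inE => /predU1P[->|/hn[j jn <-]].
    by exists i => //=; rewrite leq_max leqnn.
  by exists j => //=; rewrite leq_max jn orbT.
exists n; have han : range a (a n) by exists n.
apply: ideal_span_sub (hl _ han); first exact: ideal_span_ideal.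
by move=> b /hn/sub_ideal_span.
Qed.

(** Hilbert's argument by contradiction: choose successively [f n] of least degree in the ideal I
    outside the span of its predecessors. By the chain condition on leading coefficients, some [f n]
    has the same leading term as an element g of that span, and [f n - g] contradicts minimality. *)
Lemma noetherian_poly (A : comNzRingType) :
  noetherian A -> noetherian {poly A}.
Proof.
move=> hA S; apply: contrapT => hS.
pose I := ideal_span S.
have Iid : is_ideal I := ideal_span_ideal S.
pose bad (l : seq {poly A}) f := I f /\ ~ ideal_span [set` l] f.
have bad_ex l : (forall f, f \in l -> I f) -> exists f, bad l f.
  move=> lI; apply: contrapT => nbad; apply: hS.
  have SI : I `<=` ideal_span [set` l].
    by move=> f If; apply: contrapT => nf; apply: nbad; exists f.
  suff [l' [l'S ll']] : exists l' : seq {poly A}, (forall a, a \in l' -> S a) /\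
      forall f, f \in l -> ideal_span [set` l'] f.
    exists l'; split=> // f Sf; have := SI f (sub_ideal_span Sf).
    by apply: ideal_span_sub; first exact: ideal_span_ideal.
  elim: l lI {nbad SI} => [|g l IHl] lI; first by exists [::].
  have [l1 [l1S ll1]] := IHl (fun c cl => lI c (@mem_behead _ (g :: l) c cl)).
  (* The elements spanned by finitely many members of S form an ideal containing S, hence all of I.
     This trades finitely many generators in I for generators in S. *)
  pose J := [set f | exists l' : seq {poly A}, (forall a, a \in l' -> S a) /\
    ideal_span [set` l'] f].
  have mono (l2 l3 : seq {poly A}) f : {subset l2 <= l3} ->
      ideal_span [set` l2] f -> ideal_span [set` l3] f.
    move=> l23; apply: ideal_span_sub; first exact: ideal_span_ideal.
    by move=> h /= /l23 hl3; apply: sub_ideal_span.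
  have [l2 [l2S gl2]] : J g.
    apply: (lI g (mem_head _ _)); last first.
      move=> h Sh; exists [:: h]; split=> [c /[!inE] /eqP -> //|].
      by apply: sub_ideal_span; rewrite /= inE.
    split=> [|f h [lf [lfS hf]] [lh [lhS hh]]|c f [lf [lfS hf]]].
    - by exists [::]; split=> //; have [] := ideal_span_ideal [set` [::] : seq {poly A}].
    - exists (lf ++ lh); split.
        by move=> a; rewrite mem_cat => /orP[/lfS|/lhS].
      have [_ hD _] := ideal_span_ideal [set` lf ++ lh].
      apply: hD; [apply: mono hf | apply: mono hh] => x xl;
        by rewrite mem_cat xl ?orbT.
    - exists lf; split=> //.
      by have [_ _ hM] := ideal_span_ideal [set` lf]; apply: hM.
  exists (l1 ++ l2); split; first by move=> a; rewrite mem_cat => /orP[/l1S|/l2S].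
  move=> f; rewrite inE => /predU1P[->|/ll1].
    by apply: mono gl2 => x xl; rewrite mem_cat xl orbT.
  by apply: mono => x xl; rewrite mem_cat xl.
(* For a list not contained in I the claim is vacuous and 0 is a filler, so that [choice] gives a
   total function. *)
have min_ex l : exists f, (forall f, f \in l -> I f) ->
    bad l f /\ forall g, bad l g -> (size f <= size g)%N.
  have [lI|nlI] := pselect (forall f, f \in l -> I f); last by exists 0.
  have [f0 bf0] := bad_ex l lI.
  pose P n := `[< exists f, bad l f /\ size f = n >].
  have exP : exists n, P n by exists (size f0); apply/asboolP; exists f0.
  case: (ex_minnP exP) => n /asboolP[f [bf <-]] minf.
  by exists f => _; split=> // g bg; apply: minf; apply/asboolP; exists g.
have [pick pickP] := choice min_ex.
pose L := fix L n := if n is m.+1 then pick (L m) :: L m else [::].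
pose f n := pick (L n).
have LI n : forall g, g \in L n -> I g.
  elim: n => [//|n IHn] g; rewrite inE => /predU1P[->|/IHn //].
  by have [[]] := pickP _ IHn.
have badf n : bad (L n) (f n) by have [] := pickP _ (LI n).
have minf n g : bad (L n) g -> (size (f n) <= size g)%N.
  by have [_] := pickP _ (LI n); apply.
have fL n i : (i < n)%N -> f i \in L n.
  elim: n => // n IHn; rewrite ltnS leq_eqVlt => /predU1P[->|/IHn h].
    exact: mem_head.
  by rewrite inE h orbT.
have fsz n i : (i < n)%N -> (size (f i) <= size (f n))%N.
  move=> lt_in; apply: minf; have [If nf] := badf n; split=> // h; apply: nf.
  apply: ideal_span_sub h; first exact: ideal_span_ideal.
  have LL : {subset L i <= L n}.
    elim: n lt_in {If} => // n IHn; rewrite ltnS leq_eqVlt => /predU1P[->|lt].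
      by move=> x xl; rewrite inE xl orbT.
    by move=> x /(IHn lt) xl; rewrite inE xl orbT.
  by move=> x /= /LL xl; apply: sub_ideal_span.
have [n hn] := noetherian_sequence (fun i => lead_coef (f i)) hA.
have [_ spD spM] := ideal_span_ideal [set` L n].
(* These coefficients form an ideal of A. It contains the earlier leading coefficients, because each
   [f i] can be shifted to the degree of [f n] by a power of X. *)
pose J := [set b | exists g, [/\ ideal_span [set` L n] g,
  (size g <= size (f n))%N & g`_(size (f n)).-1 = b]].
have [g [gL gsz glc]] : J (lead_coef (f n)).
  apply: hn.
    split=> [|a b [g [gL gs <-]] [h [hL hs <-]]|c a [g [gL gs <-]]].
    - exists 0; rewrite size_poly0 coef0; split=> //.
      by have [] := ideal_span_ideal [set` L n].
    - exists (g + h); rewrite coefD; split=> //; first exact: spD.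
      by rewrite (leq_trans (size_polyD _ _)) // geq_max gs hs.
    - exists (c%:P * g); rewrite coefCM; split=> //; first exact: spM.
      by rewrite mul_polyC (leq_trans (size_scale_leq _ _)).
  move=> _ [i /= lt_in <-]; exists ('X^(size (f n) - size (f i)) * f i).
  have fi0 : f i != 0.
    apply/eqP => fi0; have [_] := badf i; rewrite fi0; apply.
    by have [] := ideal_span_ideal [set` L i].
  have si : (0 < size (f i))%N by rewrite size_poly_gt0.
  split; first by apply: spM; apply: sub_ideal_span; exact: fL.
  - by rewrite mulrC size_mulXn // subnK // fsz.
  - rewrite coefXnM; have le := fsz _ _ lt_in.
    have e : (size (f n)).-1 = (size (f n) - size (f i) + (size (f i)).-1)%N.
      by rewrite -!subn1 addnBA // subnK.
    by rewrite e ltnNge leq_addr /= addKn.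
have fn0 : f n != 0.
  apply/eqP => fi0; have [_] := badf n; rewrite fi0; apply.
  by have [] := ideal_span_ideal [set` L n].
have [If nf] := badf n.
have gI : I g.
  apply: ideal_span_sub gL => //; exact: LI.
(* The top coefficients cancel in [f n - g], which is therefore strictly smaller, yet still bad
   since g lies in the span. *)
suff : (size (f n) <= size (f n - g)%R)%N.
  rewrite leqNgt => /negP; apply.
  have le : (size (f n - g)%R <= size (f n))%N.
    by rewrite (leq_trans (size_polyD _ _)) // size_polyN geq_max leqnn gsz.
  have sn : (0 < size (f n))%N by rewrite size_poly_gt0.
  rewrite ltn_neqAle le andbT; apply/eqP => e.
  have : lead_coef (f n - g) = 0 by rewrite lead_coefE e coefB glc -lead_coefE subrr.
  by move/eqP; rewrite lead_coef_eq0 -size_poly_eq0 e -leqn0 leqNgt sn.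
apply: minf; split.
  have [_ ID IM] := Iid; apply: ID => //.
  by rewrite -mulN1r; apply: IM.
move=> h; apply: nf; rewrite -(subrK g (f n)); exact: spD.
Qed.

(** Polynomials in n variables as nested univariate ones, so that each variable costs one use of
    [noetherian_poly]. *)
Fixpoint iter_poly (A : comNzRingType) n : comNzRingType :=
  if n is m.+1 then {poly (iter_poly A m)} : comNzRingType else A.

Lemma noetherian_iter_poly (A : comNzRingType) n :
  noetherian A -> noetherian (iter_poly A n).
Proof. by move=> hA; elim: n => //= n; apply: noetherian_poly. Qed.

Fixpoint iter_eval (A : comNzRingType) (x : nat -> A) n :
    {rmorphism iter_poly A n -> A} :=
  match n with
  | 0 => (idfun : {rmorphism A -> A})
  | m.+1 => (horner_eval (x m) \o map_poly (iter_eval x m)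
              : {rmorphism {poly (iter_poly A m)} -> A})
  end.

Lemma iter_evalS (A : comNzRingType) (x : nat -> A) n (p : iter_poly A n.+1) :
  iter_eval x n.+1 p = (map_poly (iter_eval x n) (p : {poly _})).[x n].
Proof. by []. Qed.

Lemma iter_eval_cst (A : comNzRingType) n (c : A) :
  exists p : iter_poly A n, forall x, iter_eval x n p = c.
Proof.
elim: n => [|n [p hp]]; first by exists c.
by exists p%:P => x; rewrite iter_evalS map_polyC hornerC; exact: hp.
Qed.

Lemma iter_eval_coord (A : comNzRingType) n i : (i < n)%N ->
  exists p : iter_poly A n, forall x, iter_eval x n p = x i.
Proof.
elim: n => // n IHn; rewrite ltnS leq_eqVlt => /predU1P[->|/IHn[p hp]].
  by exists 'X => x; rewrite iter_evalS map_polyX hornerX.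
by exists p%:P => x; rewrite iter_evalS map_polyC hornerC; exact: hp.
Qed.

End Noetherian.

Section PolynomialFunctions.

(** Polynomial functions on any type, with B as the coordinate functions. Substitution then reduces
    to a check on coordinates, and further properties follow by induction. *)
Inductive polyf (A : pzRingType) (T : Type) (B : set (T -> A)) :
    (T -> A) -> Prop :=
| polyf_cst c : polyf B (fun=> c)
| polyf_coord b : B b -> polyf B b
| polyf_add f g : polyf B f -> polyf B g -> polyf B (fun x => f x + g x)
| polyf_mul f g : polyf B f -> polyf B g -> polyf B (fun x => f x * g x).

Lemma eq_polyf (A : pzRingType) (T : Type) (B : set (T -> A)) f g :
  f =1 g -> polyf B f -> polyf B g.
Proof. by move=> /funext ->. Qed.

Lemma polyf_comp (A : pzRingType) (T T' : Type) (B : set (T -> A))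
    (B' : set (T' -> A)) (phi : T' -> T) f :
  (forall b, B b -> polyf B' (b \o phi)) -> polyf B f -> polyf B' (f \o phi).
Proof.
move=> hB; elim=> [c|b /hB//|{}f g _ hf _ hg|{}f g _ hf _ hg].
- exact: polyf_cst.
- exact: polyf_add hf hg.
- exact: polyf_mul hf hg.
Qed.

Lemma polyf_sum (A : pzRingType) (T I : Type) (B : set (T -> A)) (r : seq I)
    (P : pred I) (f : I -> T -> A) :
  (forall i, P i -> polyf B (f i)) ->
  polyf B (fun x => \sum_(i <- r | P i) f i x).
Proof.
move=> hf; elim: r => [|i r IHr].
  by apply: (eq_polyf _ (polyf_cst B 0)) => x; rewrite big_nil.
have [Pi|/negbTE nPi] := boolP (P i); last first.
  by apply: (eq_polyf _ IHr) => x; rewrite big_cons nPi.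
by apply: (eq_polyf _ (polyf_add (hf i Pi) IHr)) => x; rewrite big_cons Pi.
Qed.

Lemma polyf_prod (A : pzRingType) (T I : Type) (B : set (T -> A)) (r : seq I)
    (P : pred I) (f : I -> T -> A) :
  (forall i, P i -> polyf B (f i)) ->
  polyf B (fun x => \prod_(i <- r | P i) f i x).
Proof.
move=> hf; elim: r => [|i r IHr].
  by apply: (eq_polyf _ (polyf_cst B 1)) => x; rewrite big_nil.
have [Pi|/negbTE nPi] := boolP (P i); last first.
  by apply: (eq_polyf _ IHr) => x; rewrite big_cons nPi.
by apply: (eq_polyf _ (polyf_mul (hf i Pi) IHr)) => x; rewrite big_cons Pi.
Qed.

Lemma polyf_exp (A : pzRingType) (T : Type) (B : set (T -> A)) f n :
  polyf B f -> polyf B (fun x => f x ^+ n).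
Proof.
move=> hf; elim: n => [|n IHn].
  exact: (polyf_cst B 1).
by apply: (eq_polyf _ (polyf_mul hf IHn)) => x; rewrite exprS.
Qed.

Lemma polyf_det (A : comPzRingType) (T : Type) (B : set (T -> A)) m
    (M : T -> 'M[A]_m) :
  (forall i j, polyf B (fun x => M x i j)) -> polyf B (fun x => \det (M x)).
Proof.
move=> hM; rewrite /determinant; apply: polyf_sum => s _.
by apply: polyf_mul; [exact: polyf_cst | apply: polyf_prod].
Qed.

Lemma polyf_mulmx (A : pzRingType) (T : Type) (B : set (T -> A)) m p q
    (M : T -> 'M[A]_(m, p)) (N : T -> 'M[A]_(p, q)) :
  (forall i j, polyf B (fun x => M x i j)) ->
  (forall i j, polyf B (fun x => N x i j)) ->
  forall i j, polyf B (fun x => (M x *m N x) i j).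
Proof.
move=> hM hN i j; 
apply: (eq_polyf (f := fun x => \sum_a M x i a * N x a j)) => [x|].
  by rewrite mxE.
by apply: polyf_sum => a _; apply: polyf_mul.
Qed.

Definition row_coords (A : Type) N : set ('rV[A]_N -> A) :=
  [set b | exists i, b = fun x : 'rV[A]_N => x 0 i].

Lemma polyf_finite_cover (F : fieldType) N (T : Type) (S : set T)
    (D : T -> 'rV[F]_N -> F) :
  (forall t, S t -> polyf (@row_coords F N) (D t)) ->
  exists m (l : 'I_m -> T), (forall a, S (l a)) /\
    forall t x, S t -> D t x != 0 -> exists a, D (l a) x != 0.
Proof.
move=> hD.
(* The padding by 0 is harmless: [iter_eval] on [iter_poly F N] reads only the first N entries. *)
pose ext (x : 'rV[F]_N) i := if insub i is Some j then x 0 j else 0.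
pose ev x : {rmorphism _ -> _} := iter_eval (ext x) N.
have evP t : exists p, S t -> forall x, D t x = ev x p.
  have [St|nSt] := pselect (S t); last by exists 0.
  suff [p hp] : exists p, forall x, D t x = ev x p by exists p.
  elim: (hD t St) => [c|_ [i ->]|f g _ [p hp] _ [q hq]|f g _ [p hp] _ [q hq]].
  - by have [p hp] := iter_eval_cst N c; exists p => x; rewrite /ev hp.
  - have [p hp] := @iter_eval_coord F N i (ltn_ord i).
    by exists p => x; rewrite /ev hp /ext valK.
  - by exists (p + q) => x; rewrite rmorphD hp hq.
  - by exists (p * q) => x; rewrite rmorphM hp hq.
have [p hp] := choice evP.
have [l [lS hl]] := noetherian_iter_poly (n := N) (@noetherian_field F) (p @` S).
have tP (a : 'I_(size l)) : exists u, S u /\ p u = l`_a.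
  by have [u Su pu] := lS _ (mem_nth 0 (ltn_ord a)); exists u.
have [t ht] := choice tP.
exists (size l), t; split=> [a|u x Su Dux]; first by have [] := ht a.
apply: contrapT => h; move/eqP: Dux; apply; rewrite hp //.
apply: (hl (p u) (imageP p Su) [set q | ev x q = 0]).
  split=> [|q r /= e1 e2|q r /= e1]; first exact: rmorph0.
  - by rewrite rmorphD e1 e2 addr0.
  - by rewrite rmorphM e1 mulr0.
move=> q /= ql; pose a := Ordinal (etrans (index_mem q l) ql).
have [Sa pa] := ht a.
have qe : q = p (t a) by rewrite pa nth_index.
apply/eqP/negP => /negP nz; apply: h; exists a.
by rewrite hp // -qe.
Qed.

End PolynomialFunctions.

(** * Differentiability and projective points *)

Section DifferentiablePolynomials.
Variables (C : numFieldType) (V : normedModType C).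
Implicit Types (f : V -> C) (z : V).

Lemma polyf_differentiable (B : set (V -> C)) f z :
  (forall b : V -> C, B b -> differentiable b z) ->
  polyf B f -> differentiable f z.
Proof.
move=> hB; elim=> [c|b /hB//|{}f g _ hf _ hg|{}f g _ hf _ hg].
- exact: differentiable_cst.
- exact: differentiableD hf hg.
- exact: differentiableM hf hg.
Qed.

Lemma row_differentiable n (f : 'I_n -> V -> C) z :
  (forall a, differentiable (f a) z) ->
  differentiable (fun x => \row_a f a x) z.
Proof.
move=> hf.
have -> : (fun x => \row_a f a x) =
    \sum_(a < n) (fun x => f a x *: (delta_mx 0 a : 'rV[C]_n)).
  apply/funext => x; rewrite fct_sumE [LHS]row_sum_delta.
  by apply: eq_bigr => a _; rewrite mxE.
apply: differentiable_sum => a; exact: differentiableZl.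
Qed.

Lemma near_neq0 f z : {for z, continuous f} -> f z != 0 ->
  \forall x \near z, f x != 0.
Proof.
by move=> cf fz; exact: cvgr_neq0 cf fz.
Qed.

End DifferentiablePolynomials.

(** For small nonzero t the difference quotient is psi itself, so factoring out t computes the
    derivative. *)
Lemma derive_of_slope (C : numFieldType) (W : normedModType C)
    (c psi : C^o -> W) (c0 : W) :
  {for 0, continuous psi} ->
  (\forall t \near 0, c t = c0 + (t : C) *: psi t) ->
  'D_1 c 0 = psi 0.
Proof.
move=> cpsi hc; have hc0 : c 0 = c0.
  by have := nbhs_singleton hc; rewrite scale0r addr0.
rewrite /derive; apply: cvg_lim; first exact: norm_hausdorff.
have : psi t @[t --> (0 : C^o)^'] --> psi 0 by exact: cvg_within_filter.
apply: cvg_trans; apply: near_eq_cvg; near=> t.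
have t0 : t != 0 by near: t; exact: nbhs_dnbhs_neq.
rewrite /= addr0 hc0 (_ : t *: 1 = t); last by rewrite /GRing.scale /= mulr1.
have -> : c t = c0 + (t : C) *: psi t by near: t; exact: nbhs_dnbhs.
by rewrite addrAC subrr add0r scalerA mulVf // scale1r.
Unshelve. all: by end_near. Qed.

Section ProjectivePoints.
Variables (C : numClosedFieldType) (n : nat).
Implicit Types (p : CP C n) (x : 'rV[C]_n.+1).

Lemma val_CP_neq0 p x : val p = <[x]>%VS -> x != 0.
Proof.
move=> e; have := eqP (valP p); rewrite e dim_vline.
by case: eqVneq.
Qed.

Lemma val_CP_scale p x : val p = <[x]>%VS ->
  exists2 a, a != 0 & hcoord p = a *: x.
Proof.
move=> e; have /vlineP[a ea] : hcoord p \in <[x]>%VS.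
  by rewrite -e; exact: memv_pick.
exists a => //; apply/eqP => a0; have := hcoord_neq0 p.
by rewrite ea a0 scale0r eqxx.
Qed.

Lemma vline_scale a x : a != 0 -> <[a *: x]>%VS = <[x]>%VS.
Proof.
move=> a0; apply/eqP; rewrite eqEsubv -!memvE memvZ ?memv_line //=.
by rewrite -[X in X \in _](scalerK a0) memvZ ?memv_line.
Qed.

Lemma val_CP_dom k p x : val p = <[x]>%VS -> aff_dom k p <-> x 0 k != 0.
Proof.
move=> /val_CP_scale[a a0 e]; rewrite /aff_dom /= e mxE mulf_eq0 negb_or a0.
by [].
Qed.

Lemma val_CP_coord k p x : val p = <[x]>%VS ->
  aff_coord k p = \row_j (x 0 (lift k j) / x 0 k).
Proof.
move=> /val_CP_scale[a a0 e]; apply/rowP => j; rewrite !mxE e !mxE.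
by rewrite invfM mulrACA divff // mul1r.
Qed.

Lemma val_CP_point k p x : val p = <[x]>%VS -> x 0 k != 0 ->
  p = aff_point k (\row_j (x 0 (lift k j) / x 0 k)).
Proof.
by move=> e xk; rewrite -(val_CP_coord k e) aff_coordK //; apply/(val_CP_dom k e).
Qed.

Lemma hcoord_aff_vect k p : aff_dom k p ->
  hcoord p = hcoord p 0 k *: aff_vect k (aff_coord k p).
Proof.
move=> pk; apply/rowP => i; rewrite !mxE; case: unliftP => [j ->|->].
  by rewrite mxE mulrC divfK.
by rewrite mulr1.
Qed.

Lemma aff_vect_diag k u : (aff_vect k u : 'rV[C]_n.+1) 0 k = 1.
Proof. by rewrite mxE unlift_none. Qed.

End ProjectivePoints.

(** * Polynomials in homogeneous coordinates and a fibre vector *)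

Section PairCoordinates.
Variables (C : numClosedFieldType) (n r : nat).

Definition pair_coords (A : Type) N M : set ('rV[A]_N * 'rV[A]_M -> A) :=
  [set b | (exists i, b = fun q : 'rV[A]_N * 'rV[A]_M => q.1 0 i) \/
           (exists i, b = fun q : 'rV[A]_N * 'rV[A]_M => q.2 0 i)].

(** Base point, scaling parameter and fibre vector: the variables of the remainder Q in
    [polyf_taylor]. *)
Definition triple_coords (A : Type) N M : set ('rV[A]_N * (A * 'rV[A]_M) -> A) :=
  [set b | [\/ exists i, b = (fun q : 'rV[A]_N * (A * 'rV[A]_M) => q.1 0 i),
               b = (fun q => q.2.1) |
               exists i, b = (fun q : 'rV[A]_N * (A * 'rV[A]_M) => q.2.2 0 i)]].

Lemma pair_coords_differentiable N M (b : 'rV[C]_N * 'rV[C]_M -> C) z :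
  pair_coords b -> differentiable b z.
Proof.
case=> -[i ->].
- apply: (differentiable_comp (f := fst) (g := fun u : 'rV[C]_N => u 0 i)).
    by apply: (@linear_differentiable _ _ _ fst) => ?; exact: cvg_fst.
  exact: differentiable_coord.
- apply: (differentiable_comp (f := snd) (g := fun u : 'rV[C]_M => u 0 i)).
    by apply: (@linear_differentiable _ _ _ snd) => ?; exact: cvg_snd.
  exact: differentiable_coord.
Qed.

Lemma ev_polyf (F : pol C n r) :
  polyf (@pair_coords C n.+1 r)
    (fun q => mpoly.meval (row_mx q.1 q.2 0) F).
Proof.
apply: (eq_polyf (f := fun q => \sum_(m <- mpoly.msupp F) mpoly.mcoeff m F *
   \prod_i (row_mx q.1 q.2 0 i) ^+ mpoly.fun_of_multinom m i)) => //.
apply: polyf_sum => m _; apply: polyf_mul; first exact: polyf_cst.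
apply: polyf_prod => i _; apply: polyf_exp; apply: polyf_coord.
case: (splitP i) => j ij; [left|right]; exists j; apply/funext => q.
  by rewrite (_ : i = lshift r j) ?row_mxEl //; apply/val_inj.
by rewrite (_ : i = rshift n.+1 j) ?row_mxEr //; apply/val_inj.
Qed.

Lemma xhomog_scale d (F : pol C n r) a (x : 'rV[C]_n.+1) (v : 'rV[C]_r) : xhomog d F ->
  mpoly.meval (row_mx (a *: x) v 0) F = a ^+ d * mpoly.meval (row_mx x v 0) F.
Proof.
move=> hF; rewrite !mpoly.mevalE mulr_sumr; apply: eq_bigr => m _.
have [->|mF] := eqVneq (mpoly.mcoeff m F) 0; first by rewrite !mul0r mulr0.
rewrite mulrCA -(hF m mF) -prodrXr !big_split_ord /=.
rewrite [X in _ = _ * X]mulrA -big_split /=.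
congr (_ * (_ * _)); apply: eq_bigr => i _; last by rewrite !row_mxEr.
by rewrite !row_mxEl mxE exprMn.
Qed.

Lemma polyf_restr0 (g : 'rV[C]_n.+1 * 'rV[C]_r -> C) :
  polyf (@pair_coords C n.+1 r) g ->
  polyf (@row_coords C n.+1) (fun x => g (x, 0)).
Proof.
apply: polyf_comp => _ [[i ->]|[i ->]]; first by apply: polyf_coord; exists i.
by apply: (eq_polyf _ (polyf_cst _ 0)) => x /=; rewrite mxE.
Qed.

(** First-order expansion along the fibre, by induction on F; L is the gradient in v at v = 0. As Q
    is polynomial, with no division by t, a function with zeros may later be substituted for t. *)
Lemma polyf_taylor (F : 'rV[C]_n.+1 * 'rV[C]_r -> C) :
  polyf (@pair_coords C n.+1 r) F ->
  exists (L : 'I_r -> 'rV[C]_n.+1 -> C) (Q : 'rV[C]_n.+1 * (C * 'rV[C]_r) -> C),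
  [/\ forall b, polyf (@row_coords C n.+1) (L b),
      polyf (@triple_coords C n.+1 r) Q,
      forall x t v, F (x, t *: v) = F (x, 0) + t * Q (x, (t, v)) &
      forall x v, Q (x, (0, v)) = \sum_b v 0 b * L b x].
Proof.
have lift3 f : polyf (@row_coords C n.+1) f ->
    polyf (@triple_coords C n.+1 r) (f \o fst).
  by apply: polyf_comp => _ [i ->]; apply: polyf_coord; constructor 1; exists i.
elim=> [c|_ [[i ->]|[i ->]]|f g hf [L [Q [hL hQ e e0]]] hg [L' [Q' [hL' hQ' e' e0']]]|
        f g hf [L [Q [hL hQ e e0]]] hg [L' [Q' [hL' hQ' e' e0']]]].
- exists (fun _ _ => 0), (fun=> 0); split=> [b|||].
  + exact: polyf_cst.
  + exact: polyf_cst.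
  + by move=> x t v; rewrite mulr0 addr0.
  + by move=> x v; rewrite big1 // => b _; rewrite mulr0.
- exists (fun _ _ => 0), (fun=> 0); split=> [b|||].
  + exact: polyf_cst.
  + exact: polyf_cst.
  + by move=> x t v; rewrite mulr0 addr0.
  + by move=> x v; rewrite big1 // => b _; rewrite mulr0.
- exists (fun b _ => (b == i)%:R), (fun q => (q.2.2 : 'rV[C]_r) 0 i); split=> [b|||].
  + exact: polyf_cst.
  + by apply: polyf_coord; constructor 3; exists i.
  + by move=> x t v; rewrite /= !mxE add0r.
  + move=> x v; rewrite (bigD1 i) //= eqxx mulr1 big1 ?addr0 // => b /negbTE ->.
    by rewrite mulr0.
- exists (fun b x => L b x + L' b x), (fun q => Q q + Q' q); split=> [b|||].
  + exact: polyf_add.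
  + exact: polyf_add.
  + by move=> x t v; rewrite e e' mulrDr addrACA.
  + move=> x v; rewrite e0 e0' -big_split; apply: eq_bigr => b _ /=.
    by rewrite mulrDr.
(* Leibniz rule; the product of the two remainders keeps one extra factor t, which is [q.2.1]. *)
- exists (fun b x => f (x, 0) * L' b x + g (x, 0) * L b x),
     (fun q => f (q.1, 0) * Q' q + g (q.1, 0) * Q q + q.2.1 * (Q q * Q' q)).
  split=> [b|||].
  + by apply: polyf_add; apply: polyf_mul => //; exact: polyf_restr0.
  + apply: polyf_add; last first.
      apply: polyf_mul; last exact: polyf_mul.
      by apply: polyf_coord; constructor 2.
    by apply: polyf_add; apply: polyf_mul => //;
      [exact: (lift3 _ (polyf_restr0 hf)) | exact: (lift3 _ (polyf_restr0 hg))].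
  + by move=> x t v; rewrite e e' /=; ring.
  + move=> x v; rewrite e0 e0' /= mul0r addr0 !mulr_sumr -big_split.
    by apply: eq_bigr => b _ /=; ring.
Qed.

End PairCoordinates.

(** * Affine charts and twists of the trivial bundle *)

Definition homog (C : pzRingType) (V : lmodType C) d (f : V -> C) : Prop :=
  forall a x, f (a *: x) = a ^+ d * f x.

Section Charts.
Variables (C : numClosedFieldType) (n r : nat).
Implicit Types (i : 'I_n.+1) (q : 'rV[C]_n * 'rV[C]_r).

Lemma aff_vect_polyf i b :
  polyf (@pair_coords C n r) (fun q => aff_vect i q.1 0 b).
Proof.
case: (unliftP i b) => [j ->|->].
  apply: (eq_polyf (f := fun q => q.1 0 j)) => [q|]; first by rewrite mxE liftK.
  by apply: polyf_coord; left; exists j.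
by apply: (eq_polyf _ (polyf_cst _ 1)) => q; rewrite aff_vect_diag.
Qed.

Lemma polyf_chart i (f : 'rV[C]_n.+1 -> C) : polyf (@row_coords C n.+1) f ->
  polyf (@pair_coords C n r) (fun q => f (aff_vect i q.1)).
Proof. by apply: polyf_comp => _ [b ->]; exact: aff_vect_polyf. Qed.

Lemma polyf_chart2 i (f : 'rV[C]_n.+1 * 'rV[C]_r -> C)
    (t : 'rV[C]_n * 'rV[C]_r -> C) :
  polyf (@pair_coords C n.+1 r) f -> polyf (@pair_coords C n r) t ->
  polyf (@pair_coords C n r) (fun q => f (aff_vect i q.1, t q *: q.2)).
Proof.
move=> hf ht; move: hf.
apply: (polyf_comp (phi := fun q => (aff_vect i q.1, t q *: q.2))).
move=> _ [[b ->]|[b ->]] /=; first exact: aff_vect_polyf.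
apply: (eq_polyf (f := fun q => t q * q.2 0 b)) => [q|]; first by rewrite /= mxE.
by apply: polyf_mul => //; apply: polyf_coord; right; exists b.
Qed.

Lemma polyf_chart3 i (f : 'rV[C]_n.+1 * (C * 'rV[C]_r) -> C)
    (t : 'rV[C]_n * 'rV[C]_r -> C) :
  polyf (@triple_coords C n.+1 r) f -> polyf (@pair_coords C n r) t ->
  polyf (@pair_coords C n r) (fun q => f (aff_vect i q.1, (t q, q.2))).
Proof.
move=> hf ht; move: hf.
apply: (polyf_comp (phi := fun q => (aff_vect i q.1, (t q, q.2)))).
move=> _ [[b ->]|->|[b ->]] //=; first exact: aff_vect_polyf.
by apply: polyf_coord; right; exists b.
Qed.

Lemma polyf_pair_differentiable (f : 'rV[C]_n * 'rV[C]_r -> C) q :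
  polyf (@pair_coords C n r) f -> differentiable f q.
Proof. by apply: polyf_differentiable => b; exact: pair_coords_differentiable. Qed.

Lemma polyf_pair_near_neq0 (f : 'rV[C]_n * 'rV[C]_r -> C) q :
  polyf (@pair_coords C n r) f -> f q != 0 -> \forall z \near q, f z != 0.
Proof.
move=> hf; apply: near_neq0; apply: differentiable_continuous.
exact: polyf_pair_differentiable.
Qed.

(** The coordinates Phi span a line at q, so one of them, of index l, is nonzero there and nearby;
    dividing by it gives a holomorphic map into the l-th affine chart. *)
Lemma holo_at_homogeneous (D : set (CP C n * 'rV[C]_r))
    (f : CP C n * 'rV[C]_r -> CP C n) i (q : CP C n * 'rV[C]_r)
    (Phi : 'I_n.+1 -> 'rV[C]_n * 'rV[C]_r -> C) :
  D q -> aff_dom i q.1 ->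
  (forall a, polyf (@pair_coords C n r) (Phi a)) ->
  (\forall z \near (aff_coord i q.1, q.2), D (aff_point i z.1, z.2) ->
     val (f (aff_point i z.1, z.2)) = <[\row_a Phi a z]>%VS) ->
  exists l, holo_at (@aff_point C n l) D f q.
Proof.
case: q => [p v] /= Dq pi hPhi hf.
have := nbhs_singleton hf => /=; rewrite aff_coordK // => /(_ Dq).
move=> /val_CP_neq0 /rV0Pn[l]; rewrite mxE => Phil; exists l.
exists i, (fun z => \row_j (Phi (lift l j) z / Phi l z)); split=> //=.
near=> z.
have Phiz : Phi l z != 0.
  by near: z; exact: polyf_pair_near_neq0.
split.
  apply: row_differentiable => a; apply: differentiableM.
    exact: polyf_pair_differentiable.
  by apply: differentiableV => //; exact: polyf_pair_differentiable.
have hz : D (aff_point i z.1, z.2) ->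
    val (f (aff_point i z.1, z.2)) = <[\row_a Phi a z]>%VS by near: z.
move=> /hz e; rewrite [LHS](val_CP_point (k := l) e) ?mxE //.
by congr aff_point; apply/rowP => j; rewrite !mxE.
Unshelve. all: by end_near. Qed.

End Charts.

Section Twist.
Variables (C : numClosedFieldType) (n : nat).

(* The direct sum of r copies of O(-d): the coordinate of a vector in the i-th
   trivialization is its coordinate in the fibre, multiplied by the d-th power
   of the i-th homogeneous coordinate of the base point. *)
Definition twist (r d : nat) : vbundle C n :=
  @VBundle C n r (fun=> 'rV[C]_r) 'I_n.+1 (@aff_dom C n)
    (fun i z => GRing.scale (hcoord z 0 i ^- d)).

Lemma proj_open_aff_dom i : Defs.proj_open (@aff_dom C n i).
Proof.
move=> k; have -> : [set u | aff_dom i (aff_point k u)] =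
    [set u : 'rV[C]_n | aff_vect k u 0 i != 0].
  by apply/seteqP; split=> u /=; move: (@val_CP_dom C n i (aff_point k u) _ erefl) => [].
case: (unliftP k i) => [j ->|->]; last first.
  by rewrite (_ : mkset _ = setT); [exact: openT | apply/seteqP; split=> u //= _;
     rewrite aff_vect_diag oner_neq0].
rewrite openE => u /= uj.
have e (w : 'rV[C]_n) : aff_vect k w 0 (lift k j) = w 0 j by rewrite mxE liftK.
rewrite /interior /= e in uj *.
have := @near_neq0 _ _ (fun w : 'rV[C]_n => w 0 j) u.
move=> /(_ (@coord_continuous _ _ _ _ _ _) uj).
by apply: filterS => w /=; rewrite e.
Qed.

Lemma twist_holomorphic r d B : holomorphic_bundle B (twist r d).
Proof.
split=> [z _|i|i z Bz zi|i j].
- by have /rV0Pn[i zi] := hcoord_neq0 z; exists i.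
- exact: proj_open_aff_dom.
- have h0 : hcoord z 0 i ^- d != 0 by rewrite invr_eq0 expf_neq0.
  by exists (fun v => (hcoord z 0 i ^- d)^-1 *: v) => v /=;
    [rewrite scalerK | rewrite scalerKV].
(* In this ratio the arbitrary scaling of [hcoord] cancels; in chart i it is a power of an entry of
   [aff_vect]. *)
- exists (fun z => ((hcoord z 0 j / hcoord z 0 i) ^+ d)%:M); split.
    move=> z v Bz zi zj /=; rewrite mul_mx_scalar scalerA expr_div_n mulrA.
    by rewrite mulVf ?mul1r // expf_neq0.
  move=> a b [p v] /= [[Bp pi] pj]; exists i.
  pose g (q : 'rV[C]_n * 'rV[C]_0) : C := (aff_vect i q.1 0 j) ^+ d *+ (a == b).
  exists g; split=> //; near=> z; split.
    apply: polyf_pair_differentiable; rewrite /g; case: (a == b).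
      by apply: polyf_exp; exact: aff_vect_polyf.
    exact: polyf_cst.
  move=> _ /=; have [c c0 e] := aff_pointP i z.1.
  have sc b' : (c *: aff_vect i z.1) 0 b' = c * aff_vect i z.1 0 b' by rewrite mxE.
  by rewrite mxE e !sc aff_vect_diag mulr1 mulrC mulKf.
Unshelve. all: by end_near. Qed.

End Twist.

(** * Extension of a twisted spray *)

Section LocalRepresentation.
Variables (C : numClosedFieldType) (n r : nat).

(** Homogeneity in x alone makes the representation insensitive to the choice of [hcoord z]; the
    nonvanishing of H delimits where it is valid. *)
Definition local_rep (U : set (CP C n)) (f : CP C n -> 'rV[C]_r -> CP C n)
    d (F : 'I_n.+1 -> 'rV[C]_n.+1 * 'rV[C]_r -> C)
    d' (H : 'rV[C]_n.+1 * 'rV[C]_r -> C) : Prop :=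
  [/\ forall a, polyf (@pair_coords C n.+1 r) (F a),
      forall a v, homog d (fun x => F a (x, v)),
      polyf (@pair_coords C n.+1 r) H,
      forall v, homog d' (fun x => H (x, v)) &
      forall z v, U z -> H (hcoord z, v) != 0 ->
        val (f z v) = <[\row_a F a (hcoord z, v)]>%VS].

Variables (Y : set (CP C n)) (f : CP C n -> 'rV[C]_r -> CP C n).
Variables (dP : nat) (P : 'rV[C]_n.+1 -> C).
Hypothesis P_polyf : polyf (@row_coords C n.+1) P.
Hypothesis P_homog : homog dP P.

Let U : set (CP C n) := [set z | Y z /\ P (hcoord z) != 0].

Hypothesis f_range : forall z v, U z -> Y (f z v).
Hypothesis f_zero : forall z, U z -> f z 0 = z.
Hypothesis f_regular : forall z v, U z -> exists d F d' H,
  local_rep U f d F d' H /\ H (hcoord z, v) != 0.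

Variables (k : 'I_n.+1) (d : nat) (F : 'I_n.+1 -> 'rV[C]_n.+1 * 'rV[C]_r -> C).
Variables (d' : nat) (H : 'rV[C]_n.+1 * 'rV[C]_r -> C).
Hypothesis F_rep : local_rep U f d F d' H.

Definition pole (x : 'rV[C]_n.+1) : C := P x * F k (x, 0) * H (x, 0).

(* Off the zeros of [pole], both the representation F near the zero section and
   the chart k are available.  In the square, one factor cancels the denominators
   F k (x, 0) and H (x, 0), and the other makes what remains tend to 0 at the
   zeros of [pole], so that the spray extends there by z. *)
Definition twisted_spray (z : CP C n) (e : 'rV[C]_r) : CP C n :=
  if pole (hcoord z) == 0 then z else f z (pole (hcoord z) ^+ 2 *: e).

Lemma pole_polyf : polyf (@row_coords C n.+1) pole.
Proof.
have [hF _ hH _ _] := F_rep.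
by apply: polyf_mul; [apply: polyf_mul => // |]; exact: polyf_restr0.
Qed.

Lemma pole_homog : homog (dP + d + d') pole.
Proof.
have [_ hF _ hH _] := F_rep; move=> a x.
rewrite /pole P_homog (hF k 0) (hH 0) !exprD; ring.
Qed.

Lemma pole_neq0 z : Y z -> pole (hcoord z) != 0 ->
  [/\ U z, F k (hcoord z, 0) != 0 & H (hcoord z, 0) != 0].
Proof.
by move=> Yz; rewrite /pole !mulf_eq0 !negb_or => /andP[/andP[Pz Fz] Hz].
Qed.

(** Since f (z, 0) = z, the vector F (z, 0) is proportional to z; cross-multiplication avoids
    denominators. *)
Lemma rep_zero z a : Y z -> pole (hcoord z) != 0 ->
  hcoord z 0 k != 0 /\
  hcoord z 0 k * F a (hcoord z, 0) = hcoord z 0 a * F k (hcoord z, 0).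
Proof.
move=> Yz /(pole_neq0 Yz)[Uz Fz Hz]; have [_ _ _ _ /(_ z 0 Uz Hz)] := F_rep.
rewrite f_zero // => /val_CP_scale[c c0 e].
have ee b : hcoord z 0 b = c * F b (hcoord z, 0) by rewrite {1}e !mxE.
split.
- by rewrite ee mulf_neq0.
- by rewrite !ee; ring.
Qed.

Lemma twisted_spray_range z e : Y z -> Y (twisted_spray z e).
Proof.
move=> Yz; rewrite /twisted_spray; case: eqVneq => // Gz.
by apply: f_range; have [] := pole_neq0 Yz Gz.
Qed.

Lemma twisted_spray0 z : Y z -> twisted_spray z 0 = z.
Proof.
move=> Yz; rewrite /twisted_spray; case: eqVneq => // Gz.
by rewrite scaler0 f_zero //; have [] := pole_neq0 Yz Gz.
Qed.

(** The twist is the degree of the square of [pole], so the scaling of [hcoord] cancels and only the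
    normalized vector [aff_vect i u] remains. *)
Lemma twisted_spray_triv i u v :
  let z := aff_point i u in
  twisted_spray z (hcoord z 0 i ^- ((dP + d + d') * 2) *: v) =
  if pole (aff_vect i u) == 0 then z
  else f z (pole (aff_vect i u) ^+ 2 *: v).
Proof.
have [a a0 e] := aff_pointP i u.
have ai : hcoord (aff_point i u) 0 i = a by rewrite e mxE aff_vect_diag mulr1.
rewrite /= /twisted_spray ai e pole_homog mulf_eq0 expf_eq0 (negbTE a0) andbF /=.
case: eqP => // _; congr f; rewrite scalerA; congr (_ *: _).
by rewrite exprMn -exprM mulrAC divff ?mul1r // expf_neq0.
Qed.

Lemma twisted_spray_holomorphic :
  holomorphic_spray (E := twist C n r ((dP + d + d') * 2)) Y Y twisted_spray.
Proof.
split=> [z e|z|i]; [exact: twisted_spray_range | exact: twisted_spray0 |].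
move=> [z0 v0] [/= Yz0 iz0]; set D := [set q | _].
have polG (i' : 'I_n.+1) : polyf (@pair_coords C n r)
    (fun q => pole (aff_vect i' q.1)) by apply: polyf_chart; exact: pole_polyf.
have polG2 (i' : 'I_n.+1) : polyf (@pair_coords C n r)
    (fun q => pole (aff_vect i' q.1) ^+ 2) by exact: polyf_exp.
set u0 := aff_coord i z0.
have z0E : z0 = aff_point i u0 by rewrite aff_coordK.
have affE (z : CP C n) : aff_dom i z ->
    exists2 a, a != 0 & hcoord z = a *: aff_vect i (aff_coord i z).
  by move=> iz; exists (hcoord z 0 i) => //; exact: hcoord_aff_vect.
(* Where [pole] is nonzero, a representation of f at the rescaled vector serves; it need not be F,
   since that vector may be far from the zero section. *)
have [G0|G0] := eqVneq (pole (aff_vect i u0)) 0; last first.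
  have [a0 a00 ea0] := affE _ iz0.
  have Gz0 : pole (hcoord z0) != 0.
    by rewrite ea0 pole_homog mulf_neq0 // expf_neq0.
  have [Uz0 _ _] := pole_neq0 Yz0 Gz0.
  have [c [F1 [c' [H1 [[hF1 oF1 hH1 oH1 rep1] H10]]]]] :=
    f_regular (pole (aff_vect i u0) ^+ 2 *: v0) Uz0.
  apply: (@holo_at_homogeneous _ _ _ D _ i (z0, v0) (fun a q =>
     F1 a (aff_vect i q.1, pole (aff_vect i q.1) ^+ 2 *: q.2))) => //.
    by move=> a; exact: polyf_chart2.
  have polH1 : polyf (@pair_coords C n r) (fun q =>
     H1 (aff_vect i q.1, pole (aff_vect i q.1) ^+ 2 *: q.2)).
    exact: polyf_chart2.
  near=> z => Dz.
  have Gz : pole (aff_vect i z.1) != 0.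
    by near: z; exact: (polyf_pair_near_neq0 (polG i)).
  have Hz : H1 (aff_vect i z.1, pole (aff_vect i z.1) ^+ 2 *: z.2) != 0.
    near: z; apply: (polyf_pair_near_neq0 polH1) => /=.
    by move: H10; rewrite ea0 oH1 mulf_eq0 negb_or => /andP[].
  have [Yz _] := Dz; have [a a_0 e] := aff_pointP i z.1.
  have Uz : U (aff_point i z.1).
    suff /(pole_neq0 Yz)[] : pole (hcoord (aff_point i z.1)) != 0 by [].
    by rewrite e pole_homog mulf_neq0 // expf_neq0.
  rewrite /= twisted_spray_triv (negbTE Gz) rep1 //; last first.
    by rewrite e oH1 mulf_neq0 // expf_neq0.
  rewrite -[RHS](vline_scale _ (expf_neq0 c a_0)); congr (<[_]>%VS).
  by apply/rowP => b; rewrite !mxE e oF1.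
have [hF oF hH oH rep] := F_rep.
have [L LP] := choice (fun a => polyf_taylor (hF a)).
have [Q QP] := choice LP.
have [_ [QH [_ hQH eH _]]] := polyf_taylor hH.
(* Phi = x_k / F k (x, 0) * F (x, pole x ^+ 2 * v), with the quotient simplified. *)
pose Phi a (q : 'rV[C]_n * 'rV[C]_r) := let x := aff_vect i q.1 in
  x 0 a + x 0 k * (P x * H (x, 0) * pole x) * Q a (x, (pole x ^+ 2, q.2)).
apply: (@holo_at_homogeneous _ _ _ D _ i (z0, v0) Phi) => //.
  move=> a; have [_ hQ _ _] := QP a.
  apply: polyf_add; first exact: aff_vect_polyf.
  apply: polyf_mul; last exact: polyf_chart3.
  apply: polyf_mul; first exact: aff_vect_polyf.
  apply: polyf_mul; last exact: polG.
  apply: polyf_mul; first exact: polyf_chart.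
  exact: (polyf_chart _ _ (polyf_restr0 hH)).
(* hh = H (x, pole x ^+ 2 * v) / H (x, 0). *)
pose hh (q : 'rV[C]_n * 'rV[C]_r) := let x := aff_vect i q.1 in
  1 + P x * F k (x, 0) * pole x * QH (x, (pole x ^+ 2, q.2)).
have polhh : polyf (@pair_coords C n r) hh.
  apply: polyf_add; first exact: polyf_cst.
  apply: polyf_mul; last exact: polyf_chart3.
  apply: polyf_mul; last exact: polG.
  apply: polyf_mul; first exact: polyf_chart.
  exact: (polyf_chart _ _ (polyf_restr0 (hF k))).
near=> z => Dz; rewrite /= twisted_spray_triv.
(* At the given zero of [pole], [hh] equals 1. Hence H is nonzero at the rescaled vectors over
   nearby points off the zeros, and F represents f there. *)
have hhz : hh z != 0.
  near: z; apply: (polyf_pair_near_neq0 polhh).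
  by rewrite /hh /= -/u0 G0 mulr0 mul0r addr0 oner_neq0.
have [a a_0 e] := aff_pointP i z.1.
case: eqVneq => [Gz|Gz].
  rewrite /=; congr (<[_]>%VS); apply/rowP => b.
  by rewrite !mxE /Phi /= Gz !mulr0 mul0r addr0 mxE.
have [Yz _] := Dz; rewrite /= in Yz.
have Gz' : pole (hcoord (aff_point i z.1)) != 0.
  by rewrite e pole_homog mulf_neq0 // expf_neq0.
have [Uz Fz Hz] := pole_neq0 Yz Gz'.
have Hz1 : H (aff_vect i z.1, 0) != 0.
  by move: Hz; rewrite e (oH 0) mulf_eq0 negb_or => /andP[].
have Fz1 : F k (aff_vect i z.1, 0) != 0.
  by move: Fz; rewrite e (oF k 0) mulf_eq0 negb_or => /andP[].
set x := aff_vect i z.1 in Gz Hz1 Fz1 e *.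
have prop b : x 0 k * F b (x, 0) = x 0 b * F k (x, 0).
  have [_] := rep_zero b Yz Gz'.
  rewrite e !mxE (oF b 0) (oF k 0) => h.
  apply: (mulfI (mulf_neq0 a_0 (expf_neq0 d a_0))).
  by rewrite -/x; move: h; rewrite -/x => h; rewrite mulrACA h; ring.
have xk : x 0 k != 0.
  have [zk _] := rep_zero k Yz Gz'.
  by move: zk; rewrite e mxE mulf_eq0 negb_or => /andP[].
have HGz : H (x, pole x ^+ 2 *: z.2) != 0.
  have -> : H (x, pole x ^+ 2 *: z.2) = H (x, 0) * hh z.
    by rewrite eH /hh /= -/x {1}/pole; rewrite /pole; ring.
  by rewrite mulf_neq0.
rewrite rep //; last by rewrite e oH mulf_neq0 // expf_neq0.
(* The ratio of the coordinates given by F to Phi: [a ^+ d] comes from rescaling x, the other factor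
   undoes the normalization in Phi. *)
have c0 : a ^+ d * (F k (x, 0) / x 0 k) != 0.
  by rewrite mulf_neq0 ?expf_neq0 // mulf_neq0 // invr_eq0.
rewrite -(vline_scale (\row_b Phi b z) c0); congr (<[_]>%VS).
apply/rowP => b; rewrite [LHS]mxE [RHS]mxE [X in _ = _ * X]mxE e oF -mulrA; congr (_ * _).
have [_ _ eF _] := QP b; rewrite eF /Phi /= -/x.
apply: (mulfI xk); rewrite [RHS]mulrA [x 0 k * (_ / _)]mulrC divfK //.
rewrite mulrDr prop {1}/pole /pole.
ring.
Unshelve. all: by end_near. Qed.
(** Quotient rule for F_j / F_k along t w: the numerator is linear in w with polynomial
    coefficients, which form N, and the squared denominator goes into c. *)
Lemma rep_derivative : exists N : 'rV[C]_n.+1 -> 'M[C]_(r, n),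
  (forall b j, polyf (@row_coords C n.+1) (fun x => N x b j)) /\
  forall z, Y z -> pole (hcoord z) != 0 -> exists2 c, c != 0 & forall w,
    'D_1 (fun t : C^o => aff_coord k (f z ((t : C) *: w))) 0 =
    c *: (w *m N (hcoord z)).
Proof.
have [hF _ hH _ rep] := F_rep.
have [L LP] := choice (fun a => polyf_taylor (hF a)).
have [Q QP] := choice LP.
have [_ [QH [_ hQH eH _]]] := polyf_taylor hH.
exists (fun x => \matrix_(b, j) (L (lift k j) b x * F k (x, 0) -
  F (lift k j) (x, 0) * L k b x)); split=> [b j|z Yz Gz].
  have [hL _ _ _] := QP (lift k j); have [hLk _ _ _] := QP k.
  apply: (eq_polyf (f := fun x => L (lift k j) b x * F k (x, 0) +
    (-1) * (F (lift k j) (x, 0) * L k b x))) => [x|].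
    by rewrite mxE mulN1r.
  have pF a : polyf (@row_coords C n.+1) (fun x => F a (x, 0)).
    exact: (polyf_restr0 (hF a)).
  apply: polyf_add; first exact: polyf_mul.
  by apply: polyf_mul; [exact: polyf_cst | exact: polyf_mul].
have [Uz Fz Hz] := pole_neq0 Yz Gz.
exists (F k (hcoord z, 0) ^- 2); first by rewrite invr_eq0 expf_neq0.
move=> w; set x := hcoord z in Fz Hz *.
have dQ (q : 'rV[C]_n.+1 * (C * 'rV[C]_r) -> C) (t0 : C^o) :
    polyf (@triple_coords C n.+1 r) q ->
    differentiable (fun t : C^o => q (x, (t : C, w)) : C) t0.
  move=> hq; apply: (polyf_differentiable (B := [set id : C^o -> C])).
    by move=> b /= ->.
  move: hq; apply: (polyf_comp (phi := fun t : C^o => (x, (t : C, w)))).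
  move=> _ [[i ->]|->|[i ->]].
  - exact: (polyf_cst _ (x 0 i)).
  - exact: polyf_coord.
  - exact: (polyf_cst _ (w 0 i)).
have dF (t0 : C^o) : differentiable (fun t : C^o => F k (x, (t : C) *: w) : C) t0.
  have [_ hQ e _] := QP k.
  rewrite (_ : (fun _ => _) =
    (fun t : C^o => F k (x, 0) + (t : C) * Q k (x, (t : C, w)))).
    apply: differentiableD; first exact: differentiable_cst.
    by apply: differentiableM => //; exact: dQ.
  by apply/funext => t; exact: e.
have dH (t0 : C^o) : differentiable (fun t : C^o => H (x, (t : C) *: w) : C) t0.
  rewrite (_ : (fun _ => _) =
    (fun t : C^o => H (x, 0) + (t : C) * QH (x, (t : C, w)))).
    apply: differentiableD; first exact: differentiable_cst.
    by apply: differentiableM => //; exact: dQ.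
  by apply/funext => t; exact: eH.
(* The increment of F_j / F_k from 0 to t, expanded by [polyf_taylor] and divided by t. *)
pose psi (t : C^o) : 'rV[C]_n := \row_j
  ((Q (lift k j) (x, (t : C, w)) * F k (x, 0) -
    F (lift k j) (x, 0) * Q k (x, (t : C, w))) /
   (F k (x, (t : C) *: w) * F k (x, 0))).
have F0 : F k (x, (0 : C) *: w) = F k (x, 0) by rewrite scale0r.
rewrite (@derive_of_slope _ _ _ psi
  (\row_j (F (lift k j) (x, 0) / F k (x, 0)))); first last.
- near=> t.
  have Ft : F k (x, (t : C) *: w) != 0.
    near: t; apply: (near_neq0 (f := fun t : C^o => F k (x, (t : C) *: w)));
      last by rewrite F0.
    exact: differentiable_continuous (dF 0).
  have Ht : H (x, (t : C) *: w) != 0.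
    near: t; apply: (near_neq0 (f := fun t : C^o => H (x, (t : C) *: w)));
      last by rewrite scale0r.
    exact: differentiable_continuous (dH 0).
  rewrite (val_CP_coord _ (rep _ _ Uz Ht)); apply/rowP => j.
  rewrite !mxE; have [_ _ e _] := QP (lift k j); have [_ _ ek _] := QP k.
  rewrite -/x e; move: Ft; rewrite ek => Ft; field.
  by rewrite Fz.
- apply: differentiable_continuous; apply: row_differentiable => j.
  apply: differentiableM.
    apply: differentiableB; apply: differentiableM;
      do ?[exact: differentiable_cst]; apply: dQ; [have [] := QP (lift k j)|
      have [] := QP k]; done.
  apply: differentiableV; last by rewrite F0 mulf_neq0.
  by apply: differentiableM => //; exact: differentiable_cst.
apply/rowP => j; rewrite !mxE F0 -expr2 mulrC; congr (_ * _).
have [_ _ _ ->] := QP (lift k j); have [_ _ _ ->] := QP k.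
rewrite mulr_suml mulr_sumr -sumrB; apply: eq_bigr => b _.
by rewrite mxE; ring.
Unshelve. all: by end_near. Qed.

(** Rescaling the fibre by the square of [pole] changes the derivative only by a nonzero scalar. *)
Lemma twisted_spray_vert_diff (N : 'rV[C]_n.+1 -> 'M[C]_(r, n)) z : Y z ->
  pole (hcoord z) != 0 ->
  (exists2 c, c != 0 & forall w,
    'D_1 (fun t : C^o => aff_coord k (f z ((t : C) *: w))) 0 =
    c *: (w *m N (hcoord z))) ->
  exists2 c, c != 0 & forall e : 'rV[C]_r,
    vert_diff k (twisted_spray z) e = c *: (e *m N (hcoord z)).
Proof.
move=> Yz Gz [c c0 hc]; exists (c * pole (hcoord z) ^+ 2).
  by rewrite mulf_neq0 // expf_neq0.
move=> e; rewrite -scalerA scalemxAl -hc /vert_diff.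
suff -> : (fun t : C^o => aff_coord k (twisted_spray z ((t : C) *: e))) =
  (fun t : C^o => aff_coord k (f z ((t : C) *: (pole (hcoord z) ^+ 2 *: e)))).
  by [].
by apply/funext => t; rewrite /twisted_spray (negbTE Gz) !scalerA mulrC.
Qed.

End LocalRepresentation.

(** * Vertical derivatives and Zariski open sets *)

Lemma aff_coord_point (C : numClosedFieldType) n (k l : 'I_n.+1) (u : 'rV[C]_n) :
  aff_coord k (aff_point l u) =
  \row_j (aff_vect l u 0 (lift k j) / aff_vect l u 0 k).
Proof. exact: val_CP_coord. Qed.

Lemma aff_dom_point (C : numClosedFieldType) n (k l : 'I_n.+1) (u : 'rV[C]_n) :
  aff_dom k (aff_point l u) <-> aff_vect l u 0 k != 0.
Proof. exact: val_CP_dom. Qed.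

(** The curve t |-> s (t e) is holomorphic near 0, lies in Y and starts at z. *)
Lemma vert_diff_tangent (C : numClosedFieldType) n (Y : set (CP C n))
    (E : vbundle C n) (s : forall z, fiber E z -> CP C n) z k (e : fiber E z) :
  holomorphic_bundle Y E -> holomorphic_spray Y Y s -> Y z -> aff_dom k z ->
  tangent Y z k (vert_diff k (s z) e).
Proof.
move=> [cov _ bij _] [sY s0 shol] Yz kz; have [i zi] := cov z Yz.
have [v ev] : exists v, triv i z v = e.
  by have [g _ gK] := bij i z Yz zi; exists (g e).
have [l [k1 [g [/= k1z hg]]]] := shol i (z, 0) (conj Yz zi).
set u1 := aff_coord k1 z in hg.
have z1 : aff_point k1 u1 = z by rewrite aff_coordK.
pose line (t : C^o) : 'rV[C]_n * 'rV[C]_(rank E) := (u1, (t : C) *: v).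
have dline t : differentiable line t.
  apply: differentiable_pair; first exact: differentiable_cst.
  by apply: (differentiableZl (k := id)).
have line0 : line 0 = (u1, 0) by rewrite /line scale0r.
have hline : \forall t \near (0 : C^o), differentiable g (line t) /\
    s z ((t : C) *: e) = aff_point l (g (line t)).
  have cl : line t @[t --> (0 : C^o)] --> (u1, 0 : 'rV[C]_(rank E)).
    by rewrite -line0; exact: differentiable_continuous (dline 0).
  near=> t.
  have [dg] : differentiable g (line t) /\
      (Y (aff_point k1 u1) /\ triv_dom i (aff_point k1 u1) ->
       s (aff_point k1 u1) (triv i (aff_point k1 u1) ((t : C) *: v)) =
       aff_point l (g (line t))).
    by near: t; exact: cl _ hg.
  rewrite z1 => /(_ (conj Yz zi)) st; split=> //.
  by rewrite -st linearZ ev.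
(* The spray is represented in the target chart l; c is the same curve read in chart k, where [den]
   is the denominator of the change of chart. *)
pose den t := aff_vect l (g (line t)) 0 k.
pose c (t : C^o) : 'rV[C]_n :=
  \row_j (aff_vect l (g (line t)) 0 (lift k j) / den t).
have dvect t b : differentiable g (line t) ->
    differentiable (fun t => aff_vect l (g (line t)) 0 b : C) t.
  move=> dg; case: (unliftP l b) => [j ->|->].
    rewrite (_ : (fun _ => _) = (fun u : 'rV[C]_n => u 0 j) \o (g \o line)).
      apply: differentiable_comp; last exact: differentiable_coord.
      exact: differentiable_comp.
    by apply/funext => t'; rewrite /= mxE liftK.
  rewrite (_ : (fun _ => _) = cst 1); first exact: differentiable_cst.
  by apply/funext => t'; rewrite aff_vect_diag.
have [dg0 sz0] := nbhs_singleton hline.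
have den0 : den 0 != 0.
  move: sz0; rewrite scale0r s0 // => ez.
  by apply/aff_dom_point; rewrite -ez.
have nden : \forall t \near (0 : C^o), den t != 0.
  by apply: near_neq0 => //; apply: differentiable_continuous; exact: dvect.
have cE : \forall t \near (0 : C^o), aff_coord k (s z ((t : C) *: e)) = c t.
  near=> t; have [_ ->] : differentiable g (line t) /\
    s z ((t : C) *: e) = aff_point l (g (line t)) by near: t.
  exact: aff_coord_point.
exists c; split.
- by rewrite -(nbhs_singleton cE) scale0r s0.
- near=> t.
  have [dg st] : differentiable g (line t) /\
    s z ((t : C) *: e) = aff_point l (g (line t)) by near: t.
  have dt : den t != 0 by near: t.
  have ct : aff_coord k (s z ((t : C) *: e)) = c t by near: t.
  split.
    apply: row_differentiable => j; apply: differentiableM; first exact: dvect.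
    by apply: differentiableV => //; exact: dvect.
  rewrite -ct aff_coordK; first exact: sY.
  by rewrite st; apply/aff_dom_point.
- rewrite /vert_diff; apply: near_eq_derive.
  by near do apply/esym.
Unshelve. all: by end_near. Qed.

(** Principal open sets form a base: outside the common zeros of S, some F in S is nonzero. *)
Lemma zariski_open_witness (C : numClosedFieldType) n r
    (O : set (CP C n * 'rV[C]_r)) q : zariski_open O -> O q ->
  exists d (H : 'rV[C]_n.+1 * 'rV[C]_r -> C),
  [/\ polyf (@pair_coords C n.+1 r) H,
      forall v, homog d (fun x => H (x, v)),
      H (hcoord q.1, q.2) != 0 &
      forall q', H (hcoord q'.1, q'.2) != 0 -> O q'].
Proof.
move=> [S [hS OS]] Oq.
have [F [SF Fq]] : exists F, S F /\ ev F q != 0.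
  apply: contrapT => h; suff : (~` O) q by [].
  rewrite OS => F SF; apply/eqP/negPn/negP => Fq; apply: h; by exists F.
have [d hd] := hS F SF.
exists d, (fun q => mpoly.meval (row_mx q.1 q.2 0) F); split=> //.
- exact: ev_polyf.
- by move=> v a x; exact: xhomog_scale.
- move=> q' Fq'; apply: contrapT => nO; have : (~` O) q' by [].
  by rewrite OS => /(_ F SF) e; move: Fq'; rewrite [X in X != _]e eqxx.
Qed.

Lemma proj_zariski_open_witness (C : numClosedFieldType) n (O : set (CP C n)) y :
  proj_zariski_open O -> O y ->
  exists d (P : 'rV[C]_n.+1 -> C),
  [/\ polyf (@row_coords C n.+1) P, homog d P, P (hcoord y) != 0 &
      forall z, P (hcoord z) != 0 -> O z].
Proof.
move=> hO Oy; have [d [H [pH oH Hy HO]]] :=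
  @zariski_open_witness C n 0 (fst @^-1` O) (y, 0) hO Oy.
exists d, (fun x => H (x, 0)); split=> //; first exact: polyf_restr0.
by move=> z Hz; exact: (HO (z, 0) Hz).
Qed.

Lemma regular_map_local_rep (C : numClosedFieldType) n r
    (D : set (CP C n * 'rV[C]_r)) (f : CP C n -> 'rV[C]_r -> CP C n)
    (U : set (CP C n)) z v :
  regular_map D (fun q => f q.1 q.2) ->
  (forall z v, U z -> D (z, v)) -> U z ->
  exists d F d' H, local_rep U f d F d' H /\ H (hcoord z, v) != 0.
Proof.
move=> freg UD Uz; have [d [F [W [hF Wop Wz hW]]]] := freg _ (UD z v Uz).
have [d' [H [pH oH Hz HW]]] := zariski_open_witness Wop Wz.
exists d, (fun a q => mpoly.meval (row_mx q.1 q.2 0) (F a)), d', H.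
split=> //; split=> //.
- by move=> a; exact: ev_polyf.
- by move=> a w c x; exact: xhomog_scale.
- move=> z' v' Uz' Hz'.
  by have [_ ->] := hW (z', v') (UD _ _ Uz') (HW (z', v') Hz').
Qed.

(** Constant matrices K and M compress [A y] to the identity of size rk. Where the compression of
    [A x] is invertible, the rank is at least rk; its determinant is a combination of minors. *)
Lemma rank_semicontinuity (F : fieldType) T (B : set (T -> F)) p q
    (A : T -> 'M[F]_(p, q)) y :
  (forall i j, polyf B (fun x => A x i j)) ->
  exists D, [/\ polyf B D, D y != 0 &
    forall x, D x != 0 -> (\rank (A y) <= \rank (A x))%N].
Proof.
move=> hA; set rk := \rank (A y).
pose K : 'M[F]_(rk, p) := pid_mx rk *m invmx (col_ebase (A y)).
pose M : 'M[F]_(q, rk) := invmx (row_ebase (A y)) *m pid_mx rk.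
exists (fun x => \det (K *m A x *m M)); split.
- apply: polyf_det => i j; apply: polyf_mulmx => [{}i {}j|{}i {}j]; last exact: polyf_cst.
  by apply: polyf_mulmx => // *; exact: polyf_cst.
- suff -> : K *m A y *m M = 1%:M by rewrite det1 oner_neq0.
  rewrite -{1}(mulmx_ebase (A y)) /K /M !mulmxA mulmxKV ?col_ebase_unit //.
  rewrite mulmxK ?row_ebase_unit // pid_mx_id ?rank_leq_row //.
  by rewrite pid_mx_id ?rank_leq_col // pid_mx_1.
- move=> x; rewrite -unitfE -/(_ \in unitmx) => /mxrank_unit <-.
  by rewrite (leq_trans (mxrankM_maxl _ _)) // mxrankM_maxr.
Qed.

(** * Finitely many sprays *)

Lemma dchoice (I : Type) (T : I -> Type) (P : forall i, T i -> Prop) :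
  (forall i, exists t, P i t) -> exists t : forall i, T i, forall i, P i (t i).
Proof.
by move=> h; exists (fun i => projT1 (cid (h i))) => i; exact: projT2 (cid (h i)).
Qed.

Section Assembly.
Variables (C : numClosedFieldType) (n : nat).
Implicit Types (Y U O : set (CP C n)).

(* A spray over Y defined on a twisted trivial bundle, together with a
   polynomial matrix whose row space is, off the zeros of [spray_pole], the
   image of the vertical derivative, read in a fixed affine chart. *)
Record twisted_datum := TwistedDatum {
  spray_rank : nat;
  spray_twist : nat;
  spray_map : CP C n -> 'rV[C]_spray_rank -> CP C n;
  spray_pole : 'rV[C]_n.+1 -> C;
  spray_jac : 'rV[C]_n.+1 -> 'M[C]_(spray_rank, n) }.

Definition good_spray Y (sg : twisted_datum) : Prop :=
  holomorphic_spray (E := twist C n (spray_rank sg) (spray_twist sg)) Y Y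
    (@spray_map sg).

Definition spray_directions k z (sg : twisted_datum) : set 'rV[C]_n :=
  [set w | exists e : 'rV[C]_(spray_rank sg), vert_diff k (@spray_map sg z) e = w].

(** Off the zeros of the pole one inclusion suffices, tangency giving the upper bound. At y both are
    needed to compare the matrix with the original spray. *)
Lemma twisted_spray_exists Y U O y k (E : vbundle C n)
    (s : forall z, fiber E z -> CP C n) :
  proj_zariski_open O -> U = Y `&` O -> U y -> aff_dom k y ->
  algebraic_bundle U E -> algebraic_spray U Y s ->
  exists sg : twisted_datum,
  [/\ good_spray Y sg,
      polyf (@row_coords C n.+1) (spray_pole sg),
      forall b j, polyf (@row_coords C n.+1) (fun x => spray_jac sg x b j) &
      spray_pole sg (hcoord y) != 0] /\
  [/\ forall z, Y z -> spray_pole sg (hcoord z) != 0 -> forall w,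
        spray_directions k z sg (w *m spray_jac sg (hcoord z)),
      forall w, exists e, vert_diff k (s y) e = w *m spray_jac sg (hcoord y) &
      forall e, exists w, vert_diff k (s y) e = w *m spray_jac sg (hcoord y)].
Proof.
move=> Oopen UE Uy ky [cov opn bij _] [sY s0 sreg].
have [i yi] := cov y Uy.
have Oy : O y by move: Uy; rewrite UE => -[].
have [d1 [P1 [pP1 oP1 P1y P1O]]] := proj_zariski_open_witness Oopen Oy.
have [d2 [P2 [pP2 oP2 P2y P2O]]] := proj_zariski_open_witness (opn i) yi.
(* P cuts out a principal neighbourhood of y in Y over which s is defined and E is trivialized. *)
pose P x := P1 x * P2 x.
have pP : polyf (@row_coords C n.+1) P by exact: polyf_mul.
have oP : homog (d1 + d2) P.
  by move=> a x; rewrite /P oP1 oP2 exprD; ring.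
pose f z v := s z (triv i z v).
pose V : set (CP C n) := [set z | Y z /\ P (hcoord z) != 0].
have VU z : V z -> U z /\ triv_dom i z.
  move=> [Yz]; rewrite /P mulf_eq0 negb_or => /andP[/P1O Oz /P2O iz].
  by rewrite UE.
have fY z v : V z -> Y (f z v) by move=> /VU[Uz _]; exact: sY.
have f0 z : V z -> f z 0 = z by move=> /VU[Uz _]; rewrite /f linear0 s0.
have freg z v : V z -> exists d F d' H,
    local_rep V f d F d' H /\ H (hcoord z, v) != 0.
  apply: (@regular_map_local_rep _ _ _ _ f V z v (sreg i)) => {}z {}v.
  exact: VU.
have Vy : V y by split; [move: Uy; rewrite UE => -[] | rewrite mulf_neq0].
have [d [F [d' [H [FH Hy]]]]] := freg y 0 Vy.
have [Yy _] := Vy.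
have hol := twisted_spray_holomorphic pP oP fY f0 freg k FH.
(* F (y, 0) is proportional to y, whose k-th coordinate is nonzero because y lies in chart k. *)
have Gy : pole P k F H (hcoord y) != 0.
  have [_ _ _ _ /(_ y 0 Vy Hy)] := FH; rewrite f0 // => e.
  have /(val_CP_dom k e) := ky; rewrite mxE => Fy.
  by rewrite /pole !mulf_neq0 //; have [] := Vy.
have [N [pN dN]] := rep_derivative k FH.
exists (@TwistedDatum (rank E) ((d1 + d2 + d + d') * 2) (twisted_spray f P k F H)
  (pole P k F H) N) => /=.
split; split=> //.
- exact: (pole_polyf pP k FH).
- move=> z Yz Gz w.
  have [c c0 hc] := twisted_spray_vert_diff Yz Gz (dN z Yz Gz).
  by exists (c^-1 *: w); rewrite hc -scalemxAl scalerKV.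
- move=> w; have [c c0 hc] := dN y Yy Gy.
  exists (triv i y (c^-1 *: w)); rewrite -[RHS](scalerKV c0) scalemxAl -hc.
  rewrite /vert_diff; suff -> : (fun t : C^o => aff_coord k
      (s y ((t : C) *: triv i y (c^-1 *: w)))) =
    (fun t : C^o => aff_coord k (f y ((t : C) *: (c^-1 *: w)))) by [].
  by apply/funext => t; rewrite /f -linearZ.
- move=> e; have [c c0 hc] := dN y Yy Gy.
  have [g _ gK] := bij i y Uy yi.
  exists (c *: g e); rewrite -scalemxAl -hc /vert_diff.
  suff -> : (fun t : C^o => aff_coord k (s y ((t : C) *: e))) =
    (fun t : C^o => aff_coord k (f y ((t : C) *: g e))) by [].
  by apply/funext => t; rewrite /f linearZ gK.
Qed.

Lemma spray_directions0 k z sg : spray_directions k z sg 0.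
Proof.
exists 0; rewrite /vert_diff.
rewrite (_ : (fun _ => _) = cst (aff_coord k (@spray_map sg z 0))).
  exact: derive_cst.
by apply/funext => t; rewrite scaler0.
Qed.

Lemma spray_directions_tangent Y k z sg w : good_spray Y sg -> Y z ->
  aff_dom k z -> spray_directions k z sg w -> tangent Y z k w.
Proof.
move=> good Yz kz [e <-].
exact: (@vert_diff_tangent _ _ _ (twist C n (spray_rank sg) (spray_twist sg)) _ z k e
  (twist_holomorphic _ _ _) good Yz kz).
Qed.

(** [tangent] is only a set of velocities; its linearity is part of this property and is obtained
    from the spanning hypothesis. *)
Definition tangent_rank Y z k rho : Prop := exists p (T : 'M[C]_(p, n)),
  \rank T = rho /\ forall w, tangent Y z k w <-> (w <= T)%MS.

Definition spanning_hyp Y y : Prop := 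
  exists U O (m : nat) (E : 'I_m -> vbundle C n)
    (s : forall (j : 'I_m) (z : CP C n), fiber (E j) z -> CP C n),
  [/\ proj_zariski_open O, U = Y `&` O & U y] /\
  [/\ forall j, algebraic_bundle U (E j),
      forall j, algebraic_spray U Y (s j) & sprays_span Y s y].

(** The Jacobians are stacked into one matrix whose row space at y is the tangent space. Its rank
    cannot drop where D is nonzero, so the directions there contain a space of dimension at least
    rho. *)
Lemma spanning_family Y y k : spanning_hyp Y y -> aff_dom k y ->
  exists (m : nat) (sg : 'I_m -> twisted_datum) (D : 'rV[C]_n.+1 -> C) rho,
  [/\ forall j, good_spray Y (sg j),
      polyf (@row_coords C n.+1) D, D (hcoord y) != 0,
      tangent_rank Y y k rho &
      forall z, Y z -> aff_dom k z -> D (hcoord z) != 0 ->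
        exists p (S : 'M[C]_(p, n)), (rho <= \rank S)%N /\
          forall w, (w <= S)%MS -> exists w_, w = \sum_j w_ j /\
            forall j, spray_directions k z (sg j) (w_ j)].
Proof.
move=> [U [W [m [E [s [[Wopen UE Uy] [hE hs span]]]]]]] ky.
have [sg hsg] := choice (fun j => twisted_spray_exists Wopen UE Uy ky (hE j) (hs j)).
pose A x := \mxcol_j spray_jac (sg j) x.
have pA i j : polyf (@row_coords C n.+1) (fun x => A x i j).
  have [[_ _ pN _] _] := hsg (tagnat.sig1 i).
  by apply: (eq_polyf _ (pN (tagnat.sig2 i) j)) => x; rewrite mxE.
have [D [pD Dy hD]] := rank_semicontinuity (hcoord y) pA.
exists m, sg, (fun x => (\prod_j spray_pole (sg j) x) * D x), (\rank (A (hcoord y))).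
have rowA x (w : 'rV[C]_n) : (w <= A x)%MS <->
    exists v : forall j, 'rV[C]_(spray_rank (sg j)),
      w = \sum_j v j *m spray_jac (sg j) x.
  split=> [/submxP[v ->]|[v ->]].
    exists (fun j => submxrow v j); rewrite -mul_mxrow_mxcol submxrowK //.
  by rewrite -mul_mxrow_mxcol submxMl.
split.
- by move=> j; have [[]] := hsg j.
- apply: polyf_mul => //; apply: polyf_prod => j _.
  by have [[]] := hsg j.
- rewrite mulf_neq0 //; apply/prodf_neq0 => j _.
  by have [[]] := hsg j.
- exists _, (A (hcoord y)); split=> // w; rewrite -(span k ky); split.
    move=> [e ->]; apply/rowA.
    have /dchoice[v hv] : forall j, exists v,
        vert_diff k (s j y) (e j) = v *m spray_jac (sg j) (hcoord y).
      by move=> j; have [_ [_ _]] := hsg j; apply.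
    by exists v; apply: eq_bigr.
  move=> /rowA[v ->].
  have /dchoice[e he] : forall j, exists e,
      vert_diff k (s j y) e = v j *m spray_jac (sg j) (hcoord y).
    by move=> j; have [_ [_ + _]] := hsg j; apply.
  by exists e; apply: eq_bigr => j _; rewrite he.
- move=> z Yz kz; rewrite mulf_eq0 negb_or => /andP[/prodf_neq0 Gz /hD rk].
  exists _, (A (hcoord z)); split=> // w /rowA[v ->].
  exists (fun j => v j *m spray_jac (sg j) (hcoord z)); split=> // j.
  by have [_ [h _ _]] := hsg j; apply: h => //; exact: Gz.
Qed.

Lemma tangent_rank_uniq Y z k rho p (T : 'M[C]_(p, n)) :
  tangent_rank Y z k rho -> (forall w, tangent Y z k w <-> (w <= T)%MS) ->
  \rank T = rho.
Proof.
move=> [q [S [<- hS]]] hT; apply/eqP; rewrite eqn_leq.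
by apply/andP; split; apply/mxrankS/row_subP => i; [apply/hS/hT | apply/hT/hS];
  exact: row_sub.
Qed.

(** Extension by 0, to pass from the sprays attached to one member of the cover to the whole finite
    family. *)
Lemma sum_extend (I J : finType) (V : nmodType) (X : J -> set V) (h : I -> J)
    (w_ : I -> V) :
  injective h -> (forall j, X j 0) -> (forall i, X (h i) (w_ i)) ->
  exists w' : J -> V, \sum_i w_ i = \sum_j w' j /\ forall j, X j (w' j).
Proof.
move=> hinj X0 hX; exists (fun j => \sum_(i | h i == j) w_ i); split.
  exact: (partition_big h xpredT).
move=> j; have [[i hij]|nh] := pselect (exists i, h i = j).
  rewrite (big_pred1 i) -?hij // => i'; exact: inj_eq.
by rewrite big_pred0 // => i; apply/eqP => hij; apply: nh; exists i.
Qed.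

(** Tangency bounds the directions from above and rank semicontinuity from below. Finite covers
    taken for each chart and each rank make the two bounds meet at every point. *)
Lemma spanning_finite Y :
  (forall y, Y y -> spanning_hyp Y y) ->
  exists (J : finType) (sg : J -> twisted_datum),
    (forall j, good_spray Y (sg j)) /\
    forall z k, Y z -> aff_dom k z -> forall w, tangent Y z k w <->
      exists w_, w = \sum_j w_ j /\
        forall j, spray_directions k z (sg j) (w_ j).
Proof.
move=> hyp.
pose T := {t : 'I_n.+1 * CP C n | Y t.2 /\ aff_dom t.1 t.2}.
pose ch (t : T) := (proj1_sig t).1; pose pt (t : T) := (proj1_sig t).2.
pose fam := {m & 'I_m -> twisted_datum}.
have data (t : T) : exists d : fam * (('rV[C]_n.+1 -> C) * nat),
  [/\ forall j, good_spray Y (projT2 d.1 j),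
      polyf (@row_coords C n.+1) d.2.1, d.2.1 (hcoord (pt t)) != 0,
      tangent_rank Y (pt t) (ch t) d.2.2 &
      forall z, Y z -> aff_dom (ch t) z -> d.2.1 (hcoord z) != 0 ->
        exists p (S : 'M[C]_(p, n)), (d.2.2 <= \rank S)%N /\
          forall w, (w <= S)%MS -> exists w_, w = \sum_j w_ j /\
            forall j, spray_directions (ch t) z (projT2 d.1 j) (w_ j)].
  case: t => -[k y] [/= Yy ky].
  have [m [sg [D [rho h]]]] := spanning_family (hyp y Yy) ky.
  by exists (existT _ m sg, (D, rho)).
have [d dP] := choice data.
(* The rank of the tangent space need not be constant on Y, and a minor of full
   size at y only bounds the rank from below, hence one cover for each rank. *)
pose S (c : 'I_n.+1 * 'I_n.+1) := [set t : T | ch t = c.1 /\ (d t).2.2 = c.2].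
have cover c : exists l : {M & 'I_M -> T}, (forall a, S c (projT2 l a)) /\
    forall t x, S c t -> (d t).2.1 x != 0 ->
      exists a, (d (projT2 l a)).2.1 x != 0.
  have [t _|M [l hl]] := @polyf_finite_cover C n.+1 T (S c) (fun t => (d t).2.1).
    by have [] := dP t.
  by exists (existT _ M l).
have [l lP] := choice cover.
pose J : finType := {c : 'I_n.+1 * 'I_n.+1 & {a : 'I_(projT1 (l c)) &
  'I_(projT1 (d (projT2 (l c) a)).1)}}.
pose sg (j : J) := projT2 (d (projT2 (l (tag j)) (tag (tagged j)))).1
  (tagged (tagged j)).
have good j : good_spray Y (sg j).
  by have [h _ _ _ _] := dP (projT2 (l (tag j)) (tag (tagged j))); exact: h.
exists J, sg; split=> // z k Yz kz w; split; last first.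
  move=> [w_ [-> hw]].
  pose t : T := exist _ (k, z) (conj Yz kz).
  have [_ _ _ [p [M [_ hM]]] _] := dP t.
  apply/hM/summx_sub => j _; apply/hM.
  exact: spray_directions_tangent (good j) Yz kz (hw j).
pose t : T := exist _ (k, z) (conj Yz kz).
have [_ _ Dt [p [M [rkM hM]]] _] := dP t.
(* The tangent dimension is one of 0, ..., n, so the covers are indexed by a finite type. *)
have rho_le : ((d t).2.2 < n.+1)%N by rewrite ltnS -rkM rank_leq_col.
pose c : 'I_n.+1 * 'I_n.+1 := (k, Ordinal rho_le).
have [lS lcov] := lP c.
have [a Da] := lcov t (hcoord z) (conj erefl erefl) Dt.
have [cha rka] := lS a; have [_ _ _ _ dir] := dP (projT2 (l c) a).
rewrite cha in dir; have [q [A [rkA hA]]] := dir z Yz kz Da.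
(* The rows of A are sums of tangent directions. As the rank of A is at least that of M, the two row
   spaces coincide. *)
have AM : (A <= M)%MS.
  apply/row_subP => i; have [w_ [-> hw]] := hA _ (row_sub i A).
  apply: summx_sub => j _; apply/hM.
  apply: spray_directions_tangent (hw j) => //.
  by have [h _ _ _ _] := dP (projT2 (l c) a); exact: h.
have MA : (M <= A)%MS.
  rewrite -(mxrank_leqif_sup AM) eqn_leq mxrankS //= rkM.
  by rewrite (leq_trans _ rkA) // rka.
move=> /hM wM; have [w_ [-> hw]] := hA w (submx_trans wM MA).
pose h (i : 'I_(projT1 (d (projT2 (l c) a)).1)) : J :=
  Tagged (fun c : 'I_n.+1 * 'I_n.+1 => {a : 'I_(projT1 (l c)) &
    'I_(projT1 (d (projT2 (l c) a)).1)})
  (Tagged (fun a : 'I_(projT1 (l c)) =>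
    'I_(projT1 (d (projT2 (l c) a)).1)) i).
apply: (@sum_extend _ J _ (fun j => spray_directions k z (sg j)) h) => //.
- by move=> i i' /eqP; rewrite /h !eq_Tagged /= => /eqP.
- by move=> j; exact: spray_directions0.
Qed.

Lemma subelliptic_of_spanning Y :
  (forall y, Y y -> spanning_hyp Y y) -> subelliptic Y.
Proof.
move=> hyp; have [J [sg [good span]]] := spanning_finite hyp.
pose sv (j : 'I_#|J|) := sg (enum_val j).
exists #|J|, (fun j => twist C n (spray_rank (sv j)) (spray_twist (sv j))),
  (fun j => @spray_map (sv j)); split=> [j|j|y Yy k ky].
- exact: twist_holomorphic.
- exact: good.
apply/seteqP; split=> w /=.
  move=> [e ->]; apply/(span y k Yy ky).
  exists (fun j => vert_diff k (@spray_map (sv (enum_rank j)) y) (e (enum_rank j))).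
  split; last by move=> j; rewrite -{1}(enum_rankK j); exists (e (enum_rank j)).
  rewrite (reindex (@enum_rank J)) //.
  by exists (@enum_val J xpredT) => j _; rewrite ?enum_rankK ?enum_valK.
move=> /(span y k Yy ky)[w_ [-> hw]].
have /dchoice[e he] := fun j : 'I_#|J| => hw (enum_val j).
exists e; rewrite (reindex (@enum_val J xpredT)); last first.
  by exists (@enum_rank J) => j _; rewrite ?enum_rankK ?enum_valK.
by apply: eq_bigr => j _; rewrite he.
Qed.

End Assembly.

Theorem proposition1p3 (R : realType) (n : nat) (Y : set (CP R[i] n))
    (hY : quasi_projective_manifold Y)
    (hspray : forall y : CP R[i] n, Y y ->
       exists (U O : set (CP R[i] n)) (m : nat)
         (E : 'I_m -> vbundle R[i] n)
         (s : forall (j : 'I_m) (z : CP R[i] n), fiber (E j) z -> CP R[i] n),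
         [/\ proj_zariski_open O, U = Y `&` O & U y] /\
         [/\ forall j, algebraic_bundle U (E j),
             forall j, algebraic_spray U Y (s j) &
             sprays_span Y s y]) :
  subelliptic Y.
Proof.
exact: subelliptic_of_spanning hspray.
Qed.
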